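(* Let $d_v,d_c\ge 2$ and $\ell\ge 0$ be integers. There exist constants $\beta=\beta(d_v,d_c,\ell)>0$ and $\gamma=\gamma(d_v,d_c,\ell)>0$ such that the following holds, both for decoders with permanently missing connections and for decoders with transiently missing connections. For the $(d_v,d_c)$-regular LDPC ensemble of length $n$, let $Z$ be the number of incorrect values held among all $n d_v$ edges at the end of the $\ell$th decoding iteration, for a random choice of code graph, channel noise, and missing connections, and let $q$ be the expected number of incorrect values held along an edge at the end of the $\ell$th iteration when the neighborhood of depth $2\ell$ of this edge is cycle-free. Then for any $\varepsilon>0$ and any $n>\frac{2\gamma}{\varepsilon}$, $$\Pr\big[\,|Z-n d_v q|>n d_v\varepsilon\,\big]\le 2e^{-\beta n\varepsilon^2}.$$
   Context: Ensemble. The $(d_v,d_c)$-regular LDPC ensemble of length $n$ (with $d_c\mid n d_v$) is the random bipartite (Tanner) multigraph with $n$ variable nodes having $d_v$ sockets each and $n d_v/d_c$ check nodes having $d_c$ sockets each, in which the $n d_v$ variable sockets are matched to the $n d_v$ check sockets by a uniformly random permutation. Code symbols take values in $\{\pm1\}$. Channel. The all-one codeword is transmitted over a binary memoryless symmetric channel (for example a BSC with outputs in $\{\pm 1\}$ or a BEC with outputs in $\{\pm1,?\}$), so that the channel values received at the $n$ variable nodes are i.i.d. Message-passing decoder. In iteration $0$ each variable node forms, for each of its edges, a message that is a function of its received channel value. In each iteration $t\ge 1$, the variable-to-check messages formed in iteration $t-1$ are sent along the edges; each check node computes for each of its edges a message that is a fixed function of the messages received on its other $d_c-1$ edges and sends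 it; then each variable node computes for each of its edges a message that is a fixed function of its channel value and the check-to-variable messages received on its other $d_v-1$ edges. Whenever a connection (edge) is missing, any message sent along it, in either direction, is received as the erasure symbol ''$?$'', which belongs to the message alphabet. Missing connections. Let $\alpha\in[0,1]$. Permanently missing: before decoding starts, each edge is removed independently with probability $\alpha$ and stays missing in all iterations. Transiently missing: in each decoding iteration, each edge is missing independently with probability $\alpha$, independently over edges and iterations. Missing-connection randomness is independent of the graph and the channel. The value held on an edge at the end of iteration $\ell$ is the message computed for this edge by its variable node in iteration $\ell$; it is incorrect if it does not represent the transmitted symbol $+1$ (an erasure counts as incorrect). For an edge $\vec e=(v,c)$ from a variable node $v$ to a check node $c$, its neighborhood of depth $2\ell$ is the subgraph consisting of all nodes and edges on non-backtracking paths of length at most $2\ell$ starting at $v$ whose first edge is not $\vec e$; it is cycle-free if it is a tree (all its nodes reached are distinct). Thus $q$ is the probability that the value held on $\vec e$ at the end of iteration $\ell$ is incorrect, given that its depth-$2\ell$ neighborhood is cycle-free (this does not depend on $n$). *)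

(* Defs.v *)
From HB Require Import structures.
From mathcomp Require Import all_boot all_order all_algebra.
From mathcomp Require Import all_classical all_reals all_analysis.

Set Implicit Arguments.
Unset Strict Implicit.
Unset Printing Implicit Defensive.
Import Order.TTheory GRing.Theory Num.Theory.

Local Open Scope classical_set_scope.
Local Open Scope ring_scope.

(* A code symbol in {+1, -1} is a bit b standing for (-1) ^+ b. *)
Definition plus_one : bool := false.
Definition minus_one : bool := true.

Section Channel.
Context (R : realType) (d : measure_display) (Y : measurableType d).

(* Binary-input symmetric channel: [transition b] is the law of the output
   when b is sent, and [flip] maps an output y to the output written -y. *)
Record bs_channel := BSChannel {
  transition : bool -> probability Y R;
  flip : Y -> Y;
  measurable_flip : measurable_fun [set: Y] flip;
  flipK : involutive flip;
  transition_flip : forall A, measurable A ->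
    transition minus_one A = transition plus_one (flip @^-1` A) }.

Definition cons_pair (n : nat) (p : Y * n.-tuple Y) : n.+1.-tuple Y :=
  [tuple of p.1 :: p.2].

Lemma measurable_cons_pair (n : nat) : measurable_fun setT (@cons_pair n).
Proof. exact: measurable_cons. Qed.

HB.instance Definition _ (n : nat) :=
  isMeasurableFun.Build _ _ _ _ (@cons_pair n) (@measurable_cons_pair n).

(* Memoryless use of the channel: the joint law of the outputs is the product
   of the laws [transition x_i]. *)
Fixpoint channel_law (W : bs_channel) (n : nat) :
    n.-tuple bool -> probability (n.-tuple Y) R :=
  match n with
  | 0 => fun _ => \d_([tuple] : 0.-tuple Y)
  | k.+1 => fun x =>
      distribution (transition W (thead x) \x channel_law W (behead_tuple x))%E
                   (@cons_pair k)
  end.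

End Channel.

Section Ensemble.
Context (dv dc n : nat).

Definition num_checks : nat := (n * dv) %/ dc.

(* (v, j) is the j-th socket of variable node v, (c, k) the k-th socket of
   check node c. *)
Definition var_socket : finType := ('I_n * 'I_dv)%type.
Definition check_socket : finType := ('I_num_checks * 'I_dc)%type.

(* A bijection between the two sets of sockets, given together with its
   inverse. *)
Definition matching : finType :=
  {f : {ffun var_socket -> check_socket} * {ffun check_socket -> var_socket} |
    [forall e, f.2 (f.1 e) == e] && [forall s, f.1 (f.2 s) == s]}.

Definition to_check (G : matching) (e : var_socket) : check_socket :=
  (val G).1 e.
Definition to_var (G : matching) (s : check_socket) : var_socket :=
  (val G).2 s.

(* An edge of the Tanner multigraph is named by its variable socket. *)
Definition edge : finType := var_socket.

Definition node : finType := ('I_n + 'I_num_checks)%type.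

(* A dart is an edge with a direction; (e, true) goes from the variable node
   to the check node. *)
Definition dart : finType := (edge * bool)%type.

Definition dart_head (G : matching) (a : dart) : node :=
  if a.2 then inr (to_check G a.1).1 else inl a.1.1.
Definition dart_tail (G : matching) (a : dart) : node :=
  if a.2 then inl a.1.1 else inr (to_check G a.1).1.

Definition nonbacktracking (G : matching) : rel dart :=
  [rel a b | (dart_head G a == dart_tail G b) && (a.1 != b.1)].

(* The dart (e, false) arrives at the variable node of e, so its
   non-backtracking continuations are the non-backtracking paths that start at
   this node and whose first edge is not e. *)
Definition cycle_free (G : matching) (depth : nat) (e : edge) : Prop :=
  forall p1 p2 : seq dart,
    path (nonbacktracking G) (e, false) p1 -> (size p1 <= depth)%N ->
    path (nonbacktracking G) (e, false) p2 -> (size p2 <= depth)%N ->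
    dart_head G (last (e, false) p1) = dart_head G (last (e, false) p2) ->
    p1 = p2.

End Ensemble.

Section Decoding.
Context (dv dc : nat) (d d' : measure_display).
Context (Y : measurableType d) (M : measurableType d').

(* [decide m] is the code symbol represented by the message m, if any. *)
Record decoder := Decoder {
  erasure : M;
  decide : M -> option bool;
  initial_map : Y -> M;
  check_map : dc.-1.-tuple M -> M;
  var_map : Y * dv.-1.-tuple M -> M;
  decide_erasure : decide erasure = None;
  measurable_decide : forall b, measurable [set m | decide m = Some b];
  measurable_initial_map : measurable_fun [set: Y] initial_map;
  measurable_check_map : measurable_fun [set: dc.-1.-tuple M] check_map;
  measurable_var_map : measurable_fun [set: Y * dv.-1.-tuple M] var_map }.

Context (D : decoder) (n : nat).

(* [missing t e] tells whether edge e is missing in iteration t. *)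
Definition missing_process := nat -> edge dv n -> bool.

Definition receive (missing : missing_process) (t : nat) (e : edge dv n)
  (m : M) : M := if missing t e then erasure D else m.

(* The message formed in iteration t by the variable node of e for e. *)
Fixpoint var_message (G : matching dv dc n) (missing : missing_process)
    (y : n.-tuple Y) (t : nat) (e : edge dv n) : M :=
  match t with
  | 0 => initial_map D (tnth y e.1)
  | s.+1 =>
      let check_message (f : edge dv n) : M :=
        let: (c, k) := to_check G f in
        check_map D
          [tuple (let g := to_var G (c, lift k i) in
                  receive missing s.+1 g (var_message G missing y s g))
          | i < dc.-1] in
      let: (v, j) := e in
      var_map D
        (tnth y v,
         [tuple (let f := (v, lift j i) : edge dv n in
                 receive missing s.+1 f (check_message f))
         | i < dv.-1])
  end.

Definition incorrect (G : matching dv dc n) (missing : missing_process)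
    (y : n.-tuple Y) (l : nat) (e : edge dv n) : bool :=
  decide D (var_message G missing y l e) != Some plus_one.

Definition num_incorrect (G : matching dv dc n) (missing : missing_process)
    (y : n.-tuple Y) (l : nat) : nat :=
  #|[set e : edge dv n | incorrect G missing y l e]|.

End Decoding.

Section Probability.
Context (R : realType).

Inductive missing_mode := Permanent | Transient.

Definition bernoulli_weight (alpha : R) (I : finType) (x : {ffun I -> bool}) :
    R := \prod_(i : I) (if x i then alpha else 1 - alpha).

(* Mean of f over the missing connections in iterations 0, ..., l. *)
Definition missing_mean (mode : missing_mode) (alpha : R) (dv n l : nat)
    (f : missing_process dv n -> R) : R :=
  match mode with
  | Permanent =>
      \sum_(x : {ffun edge dv n -> bool})
        bernoulli_weight alpha x * f (fun _ e => x e)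
  | Transient =>
      \sum_(x : {ffun 'I_l.+1 * edge dv n -> bool})
        bernoulli_weight alpha x * f (fun t e => x (inord t, e))
  end.

Context (d : measure_display) (Y : measurableType d).

(* Probability of an event in l iterations on the ensemble of length n, for a
   uniform matching, the all-one codeword sent over the channel W, and
   independent missing connections. *)
Definition ensemble_prob (dv dc n l : nat) (W : bs_channel R Y)
    (mode : missing_mode) (alpha : R)
    (E : matching dv dc n -> missing_process dv n -> n.-tuple Y -> Prop) : R :=
  \sum_(G : matching dv dc n)
    #|matching dv dc n|%:R^-1 *
    missing_mean mode alpha l (fun x =>
      fine (channel_law W (nseq_tuple n plus_one) [set y | E G x y])).

Context (d' : measure_display) (M : measurableType d').

Definition cycle_free_prob (dv dc n l : nat) (W : bs_channel R Y)
    (mode : missing_mode) (alpha : R) (e : edge dv n) : R :=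
  ensemble_prob l W mode alpha
    (fun (G : matching dv dc n) _ _ => cycle_free G (2 * l) e).

(* Conditional probability that the value held on e at the end of iteration l
   is incorrect, given that the depth-2l neighborhood of e is cycle-free. *)
Definition cycle_free_error (dv dc n l : nat) (W : bs_channel R Y)
    (D : decoder dv dc Y M) (mode : missing_mode) (alpha : R)
    (e : edge dv n) : R :=
  ensemble_prob l W mode alpha
    (fun G x y => incorrect D G x y l e /\ cycle_free G (2 * l) e)
  / cycle_free_prob dc l W mode alpha e.

(* Since [cycle_free_error] depends neither on the length nor on the edge, q is
   obtained from any length and edge for which the conditioning event has
   positive probability. *)
Definition is_cycle_free_error (dv dc l : nat) (W : bs_channel R Y)
    (D : decoder dv dc Y M) (mode : missing_mode) (alpha q : R) : Prop :=
  exists (n : nat) (e : edge dv n),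
    [/\ (dc %| n * dv)%N, 0 < cycle_free_prob dc l W mode alpha e
      & q = cycle_free_error l W D mode alpha e].

End Probability.

(* Main.v *)
(* Given the graph and the missing connections, the number Z of incorrect values
   is a function of independent channel outputs; given the graph, its mean is a
   function of independent bits; and the resulting mean is a function of a uniform
   permutation, that is, of a product of independent transpositions.  A message
   depends on boundedly many edges, so changing one output, one bit or one
   transposition changes Z by a bounded amount, and three applications of
   McDiarmid's bound on the moment generating function give concentration of Z
   around its mean.

   The mean is close to n dv q: a message is computed by unfolding the graph into
   a computation tree, and when the neighborhood is cycle-free this unfolding is
   injective, so that the law of the message is the one on the tree, independently
   of n and of the graph.  A neighborhood fails to be cycle-free with probability
   O(1/n), since the first collision between two explored paths is destroyed by
   switching the colliding edge with almost any other edge. *)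
Require Import Defs.
From mathcomp Require Import all_boot all_order all_algebra.
From mathcomp Require Import fingroup perm zify ring lra.
From mathcomp Require Import all_classical all_reals all_analysis measurable_realfun.
Import Order.TTheory GRing.Theory Num.Theory.
Local Open Scope ring_scope.

(** * Means of bounded measurable functions *)

Section ExponentialBounds.
Set Implicit Arguments. Unset Strict Implicit.
Context (R : realType).

(** Squaring [1 - x / 2 <= expR (- (x / 2))] bounds [expR x] by the inverse of [(1 - x / 2) ^+ 2];
    the quadratic dominates that inverse because the excess factors through
    [(1 - x) * (5 / 2 - x)]. *)
Lemma expR_le_quadratic (x : R) : x <= 1 -> expR x <= 1 + x + 2 * x ^+ 2.
Proof.
move=> x1; have h : 0 < 1 - x / 2 by lra.
have e1 : (1 - x / 2) <= expR (- (x / 2)).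
  exact: le_trans (expR_ge1Dx _).
have e2 : expR x * expR (- (x / 2)) ^+ 2 = 1.
  by rewrite expr2 -!expRD (_ : _ + _ = 0) ?expR0//; lra.
have e3 : expR x * (1 - x / 2) ^+ 2 <= 1.
  by rewrite -[leRHS]e2 ler_wpM2l ?expR_ge0// lerXn2r ?nnegrE ?expR_ge0// ltW.
rewrite -(@ler_pM2r _ ((1 - x / 2) ^+ 2)) ?exprn_gt0//.
apply: le_trans e3 _.
have -> : (1 + x + 2 * x ^+ 2) * (1 - x / 2) ^+ 2
  = 1 + x ^+ 2 * ((1 - x) * (5 / 2 - x) / 2) by field.
by rewrite lerDl mulr_ge0 ?sqr_ge0// divr_ge0// mulr_ge0//; lra.
Qed.

(** A substitute for Hoeffding's lemma: for a centred variable the linear term averages to zero and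
    only the Gaussian-type factor is left. *)
Lemma expR_le_id_expR_sqr (x : R) : expR x <= x + expR (2 * x ^+ 2).
Proof.
have [x1|x1] := leP x 1.
  apply: le_trans (expR_le_quadratic x1) _.
  by have := expR_ge1Dx (2 * x ^+ 2); lra.
apply: (@le_trans _ _ (expR (2 * x ^+ 2))); last by rewrite lerDr; lra.
by rewrite ler_expR; nra.
Qed.

End ExponentialBounds.

Section BoundedMean.
Set Implicit Arguments. Unset Strict Implicit.
Local Open Scope classical_set_scope.
Context (R : realType).

(** Such functions are integrable for every probability and stable under the operations below, so
    means need no further integrability conditions. *)
Definition bounded_measurable d (T : measurableType d) (f : T -> R) :=
  measurable_fun [set: T] f /\ exists B, forall x, `|f x| <= B.

Definition mean d (T : measurableType d) (P : probability T R) (f : T -> R) :=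
  \int[P]_x f x.

Section OneSpace.
Context d (T : measurableType d) (P : probability T R).
Implicit Types f g : T -> R.

Lemma bounded_measurable_integrable f :
  bounded_measurable f -> P.-integrable setT (EFin \o f).
Proof.
move=> [mf [B fB]]; apply: measurable_bounded_integrable => //.
  by apply: le_lt_trans (probability_le1 P measurableT) _; rewrite ltry.
by exists B; split; rewrite ?num_real// => ? ? ? _; apply: le_trans (fB _) _;
  apply: ltW.
Qed.

Lemma bounded_measurable_cst (a : R) : bounded_measurable (fun _ : T => a).
Proof. by split; [exact: measurable_cst|exists `|a|]. Qed.

Lemma bounded_measurableD f g : bounded_measurable f -> bounded_measurable g ->
  bounded_measurable (fun x => f x + g x).
Proof.
move=> [mf [B fB]] [mg [C gC]]; split; first exact: measurable_funD.
by exists (B + C) => x; rewrite (le_trans (ler_normD _ _))// lerD.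
Qed.

Lemma bounded_measurableZ a f : bounded_measurable f ->
  bounded_measurable (fun x => a * f x).
Proof.
move=> [mf [B fB]]; split; first by apply: measurable_funM.
by exists (`|a| * B) => x; rewrite normrM ler_wpM2l.
Qed.

Lemma bounded_measurable_expR f : bounded_measurable f ->
  bounded_measurable (fun x => expR (f x)).
Proof.
move=> [mf [B fB]]; split; first exact: (measurableT_comp (@measurable_expR _) mf).
exists (expR B) => x; rewrite ger0_norm ?expR_ge0// ler_expR.
by rewrite (le_trans (ler_norm _)).
Qed.

Lemma bounded_measurable_comp d' (T' : measurableType d') (h : T' -> T) f :
  measurable_fun setT h -> bounded_measurable f -> bounded_measurable (f \o h).
Proof.
move=> mh [mf [B fB]]; split; first exact: measurableT_comp.
by exists B => x; exact: fB.
Qed.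

Lemma bounded_measurable_sum (I : Type) (r : seq I) (h : I -> T -> R) :
  (forall i, bounded_measurable (h i)) ->
  bounded_measurable (fun x => \sum_(i <- r) h i x).
Proof.
move=> bh; elim: r => [|i r IH].
  under eq_fun do rewrite big_nil; exact: bounded_measurable_cst.
by under eq_fun do rewrite big_cons; apply: bounded_measurableD.
Qed.

Lemma bounded_measurable_bool (b : T -> bool) :
  measurable_fun setT b -> bounded_measurable (fun x => (b x)%:R).
Proof.
move=> mb; split; last first.
  by exists 1 => x; case: (b x); rewrite ?normr1 ?normr0.
have -> : (fun x => (b x)%:R) = (fun x => if b x then 1 else 0) :> (T -> R).
  by apply/funext => x; case: (b x).
exact: (measurable_fun_ifT mb (measurable_cst _) (measurable_cst _)).
Qed.

Lemma eq_mean f g : f =1 g -> mean P f = mean P g.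
Proof. by move=> fg; apply: eq_Rintegral => x _. Qed.

Lemma mean_cst a : mean P (fun _ => a) = a.
Proof.
have PT : P setT = 1%E by exact: probability_setT.
by rewrite /mean Rintegral_cst// [X in fine X]PT mulr1.
Qed.

Lemma meanD f g : bounded_measurable f -> bounded_measurable g ->
  mean P (fun x => f x + g x) = mean P f + mean P g.
Proof. by move=> /bounded_measurable_integrable ? /bounded_measurable_integrable ?;
  rewrite /mean RintegralD. Qed.

Lemma meanZ a f : bounded_measurable f ->
  mean P (fun x => a * f x) = a * mean P f.
Proof. by move=> /bounded_measurable_integrable ?; rewrite /mean RintegralZl. Qed.

Lemma le_mean f g : bounded_measurable f -> bounded_measurable g ->
  (forall x, f x <= g x) -> mean P f <= mean P g.
Proof.
by move=> /bounded_measurable_integrable ? /bounded_measurable_integrable ? fg;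
  apply: le_Rintegral.
Qed.

Lemma mean_sum (I : Type) (r : seq I) (h : I -> T -> R) :
  (forall i, bounded_measurable (h i)) ->
  mean P (fun x => \sum_(i <- r) h i x) = \sum_(i <- r) mean P (h i).
Proof.
move=> bh; elim: r => [|i r IH].
  by under eq_mean do rewrite big_nil; rewrite mean_cst big_nil.
under eq_mean do rewrite big_cons.
by rewrite meanD// ?IH ?big_cons//; apply: bounded_measurable_sum.
Qed.

Lemma mean_dist_le f a c : bounded_measurable f ->
  (forall x, `|f x - a| <= c) -> `|mean P f - a| <= c.
Proof.
move=> bf fa; rewrite ler_distl; apply/andP; split.
  rewrite -(mean_cst (a - c)); apply: le_mean => //.
    exact: bounded_measurable_cst.
  by move=> x; have := fa x; rewrite ler_distl => /andP[].
rewrite -(mean_cst (a + c)); apply: le_mean => //.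
  exact: bounded_measurable_cst.
by move=> x; have := fa x; rewrite ler_distl => /andP[].
Qed.

Lemma mean_lipschitz f g c : bounded_measurable f -> bounded_measurable g ->
  (forall x, `|f x - g x| <= c) -> `|mean P f - mean P g| <= c.
Proof.
move=> bf bg fg.
have bg' := bounded_measurableZ (-1) bg.
rewrite -mulN1r -(meanZ _ bg) -meanD// -[X in `|X|]subr0.
by apply: mean_dist_le; [exact: bounded_measurableD|move=> x; rewrite subr0 mulN1r].
Qed.

Lemma mean_prob (A : set T) : measurable A ->
  fine (P A) = mean P (fun x => (x \in A)%:R).
Proof.
move=> mA; rewrite /mean /Rintegral; congr fine.
by rewrite -(setIT A) -integral_indic// setIT.
Qed.

(** Oscillation at most [c] keeps [f] within [c] of its mean, and the centred variable is fed to
    [expR_le_id_expR_sqr]. *)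
Lemma mean_expR_le f c lam : bounded_measurable f ->
  (forall x y, `|f x - f y| <= c) ->
  mean P (fun x => expR (lam * f x))
    <= expR (lam * mean P f + 2 * lam ^+ 2 * c ^+ 2).
Proof.
move=> bf fc; set m := mean P f.
have mfc x : `|f x - m| <= c.
  by rewrite distrC; apply: mean_dist_le => // y.
have blf : bounded_measurable (fun x => lam * f x + (- (lam * m))).
  by apply: bounded_measurableD (bounded_measurable_cst _); exact: bounded_measurableZ.
have b1 : bounded_measurable (fun x => expR (lam * f x + (- (lam * m)))).
  exact: bounded_measurable_expR.
have -> : mean P (fun x => expR (lam * f x)) =
    expR (lam * m) * mean P (fun x => expR (lam * f x + (- (lam * m)))).
  rewrite -(meanZ _ b1)//; apply: eq_mean => x.
  by rewrite -expRD; congr expR; ring.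
rewrite expRD ler_wpM2l ?expR_ge0//.
(* The centred linear part has mean zero, so the constant equals the mean of the pointwise upper
   bound. *)
have -> : expR (2 * lam ^+ 2 * c ^+ 2) = mean P
    (fun x => (lam * f x + - (lam * m)) + expR (2 * lam ^+ 2 * c ^+ 2)).
  rewrite meanD// ?mean_cst; last exact: bounded_measurable_cst.
  rewrite meanD ?mean_cst ?meanZ//; first by rewrite -/m subrr add0r.
    exact: bounded_measurableZ.
  exact: bounded_measurable_cst.
apply: le_mean => //.
  by apply: bounded_measurableD => //; exact: bounded_measurable_cst.
move=> x; apply: le_trans (expR_le_id_expR_sqr _) _.
rewrite lerD2l ler_expR -mulrA ler_wpM2l// -mulrBr exprMn ler_wpM2l ?sqr_ge0//.
by rewrite -[leLHS]real_normK ?num_real// lerXn2r ?nnegrE// (le_trans (normr_ge0 _) (mfc x)).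
Qed.

End OneSpace.

Lemma mean_distribution d d' (T : measurableType d) (T' : measurableType d')
    (P : probability T R) (X : {RV P >-> T'}) (f : T' -> R) :
  bounded_measurable f -> mean (distribution P X) f = mean P (f \o X).
Proof.
move=> bf; rewrite /mean /Rintegral integral_distribution//.
  by apply/measurable_EFinP; case: bf.
exact: (bounded_measurable_integrable _ (bounded_measurable_comp _ bf)).
Qed.

Section Product.
Context d1 d2 (T1 : measurableType d1) (T2 : measurableType d2).
Context (P1 : probability T1 R) (P2 : probability T2 R).

Lemma bounded_measurable_section (f : T1 * T2 -> R) x :
  bounded_measurable f -> bounded_measurable (fun y => f (x, y)).
Proof.
by move=> bf; apply: (bounded_measurable_comp _ bf); exact: pair1_measurable.
Qed.

Lemma bounded_measurable_mean (f : T1 * T2 -> R) :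
  bounded_measurable f -> bounded_measurable (fun x => mean P2 (fun y => f (x, y))).
Proof.
move=> bf; split; last first.
  have [_ [B fB]] := bf; exists B => x; rewrite -[X in `|X|]subr0.
  by apply: mean_dist_le => [|y]; [exact: bounded_measurable_section|rewrite subr0].
rewrite /mean /Rintegral.
have i12 : (P1 \x P2)%E.-integrable setT (EFin \o f).
  exact: bounded_measurable_integrable.
apply: measurableT_comp; first exact: fine_measurable.
exact: (measurable_fubini_F i12).
Qed.

Lemma mean_prod (f : T1 * T2 -> R) : bounded_measurable f ->
  mean (P1 \x P2)%E f = mean P1 (fun x => mean P2 (fun y => f (x, y))).
Proof.
move=> bf; have i12 : (P1 \x P2)%E.-integrable setT (EFin \o f).
  exact: bounded_measurable_integrable.
rewrite /mean /Rintegral -(integral12_prod_meas1 i12); congr fine.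
apply: eq_integral => x _; rewrite /fubini_F /= fineK//.
apply: integrable_fin_num => //.
exact: (bounded_measurable_integrable _ (bounded_measurable_section x bf)).
Qed.

Lemma mean_swap (f : T1 * T2 -> R) : bounded_measurable f ->
  mean P1 (fun x => mean P2 (fun y => f (x, y))) =
  mean P2 (fun y => mean P1 (fun x => f (x, y))).
Proof.
move=> bf; have i12 : (P1 \x P2)%E.-integrable setT (EFin \o f).
  exact: bounded_measurable_integrable.
rewrite -mean_prod// /mean /Rintegral -(integral21_prod_meas1 i12); congr fine.
apply: eq_integral => y _; rewrite /fubini_G /= fineK//.
apply: integrable_fin_num => //.
apply: (bounded_measurable_integrable _ (f := fun x => f (x, y))).
by apply: (bounded_measurable_comp _ bf); exact: pair2_measurable.
Qed.

End Product.
End BoundedMean.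

(** * Independent channel outputs *)

Section MemorylessMean.
Set Implicit Arguments. Unset Strict Implicit.
Local Open Scope classical_set_scope.
Context (R : realType) (d : measure_display) (Y : measurableType d).
Context (W : bs_channel R Y).

Definition iid_law n := channel_law W (nseq_tuple n plus_one).

Lemma iid_mean0 (f : 0.-tuple Y -> R) : mean (iid_law 0) f = f [tuple].
Proof.
rewrite -(mean_cst (iid_law 0) (f [tuple])); apply: eq_mean => t.
by rewrite tuple0.
Qed.

Lemma measurable_cons_tuple n : measurable_fun setT
  (fun p : Y * n.-tuple Y => [tuple of p.1 :: p.2]).
Proof. exact: measurable_cons. Qed.

Lemma iid_meanS n (f : n.+1.-tuple Y -> R) : bounded_measurable f ->
  mean (iid_law n.+1) f = mean (transition W plus_one)
    (fun y => mean (iid_law n) (fun t => f [tuple of y :: t])).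
Proof.
move=> bf; rewrite {1}/iid_law /=.
have -> : behead_tuple (nseq_tuple n.+1 plus_one) = nseq_tuple n plus_one.
  exact: val_inj.
rewrite mean_distribution// mean_prod//.
by apply: (bounded_measurable_comp _ bf); exact: measurable_cons_tuple.
Qed.

Lemma bounded_measurable_cons n (f : n.+1.-tuple Y -> R) : bounded_measurable f ->
  bounded_measurable (fun p : Y * n.-tuple Y => f [tuple of p.1 :: p.2]).
Proof.
by move=> bf; apply: (bounded_measurable_comp _ bf); exact: measurable_cons_tuple.
Qed.

Lemma bounded_measurable_cons1 n (f : n.+1.-tuple Y -> R) y :
  bounded_measurable f ->
  bounded_measurable (fun t : n.-tuple Y => f [tuple of y :: t]).
Proof.
move=> /bounded_measurable_cons bf.
exact: (bounded_measurable_section y bf).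
Qed.

(* McDiarmid's inequality in exponential form: each coordinate contributes the
   one-variable bound [mean_expR_le]. *)
Lemma iid_mean_expR_le n (f : n.-tuple Y -> R) c lam : bounded_measurable f ->
  (forall t t' i, (forall j, j != i -> tnth t j = tnth t' j) ->
     `|f t - f t'| <= c) ->
  mean (iid_law n) (fun t => expR (lam * f t))
    <= expR (lam * mean (iid_law n) f + n%:R * (2 * lam ^+ 2 * c ^+ 2)).
Proof.
elim: n f => [|n IH] f bf fc; first by rewrite !iid_mean0 mul0r addr0.
have bcons := bounded_measurable_cons bf.
pose g y := mean (iid_law n) (fun t => f [tuple of y :: t]).
have bg : bounded_measurable g by exact:
  (bounded_measurable_mean (transition W plus_one) (iid_law n) bcons).
have bef : bounded_measurable (fun t => expR (lam * f t)).
  exact/bounded_measurable_expR/bounded_measurableZ.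
rewrite !iid_meanS// -/g.
set K := 2 * lam ^+ 2 * c ^+ 2.
apply: (@le_trans _ _ (mean (transition W plus_one)
    (fun y => expR (n%:R * K) * expR (lam * g y)))).
  apply: le_mean.
  - exact: (bounded_measurable_mean (transition W plus_one) (iid_law n) (bounded_measurable_cons bef)).
  - exact/bounded_measurableZ/bounded_measurable_expR/bounded_measurableZ.
  - move=> y; rewrite -expRD [_ * K + _]addrC; apply: IH.
      exact: bounded_measurable_cons1.
    move=> t t' i tt'; apply: (fc _ _ (lift ord0 i)) => j.
    case: (unliftP ord0 j) => [k ->|->] // ki.
    by rewrite !tnthS; apply: tt'; apply: contra_neq ki => ->.
rewrite meanZ; last exact/bounded_measurable_expR/bounded_measurableZ.
rewrite -[n.+1]add1n natrD mulrDl mul1r addrA expRD mulrC ler_wpM2r ?expR_ge0//.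
apply: mean_expR_le => // y y'; apply: mean_lipschitz => [||t].
- exact: bounded_measurable_cons1.
- exact: bounded_measurable_cons1.
- by apply: (fc _ _ ord0) => j; case: (unliftP ord0 j) => [k ->|->] //; rewrite !tnthS.
Qed.

(** The law is built by peeling off the head; insertion at [j] lets an arbitrary coordinate be
    integrated out instead. *)
Definition insert_tuple n (j : 'I_n.+1) (y : Y) (t : n.-tuple Y) : n.+1.-tuple Y :=
  [tuple (if unlift j i is Some k then tnth t k else y) | i < n.+1].

Lemma insert_tuple0 n (y : Y) (t : n.-tuple Y) :
  insert_tuple ord0 y t = [tuple of y :: t].
Proof.
apply: eq_from_tnth => i; rewrite tnth_mktuple.
by case: unliftP => [k ->|->]; rewrite ?tnthS ?tnth0.
Qed.

Lemma insert_tupleS n (j : 'I_n.+1) (y z : Y) (t : n.-tuple Y) :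
  insert_tuple (lift ord0 j) y [tuple of z :: t] =
  [tuple of z :: insert_tuple j y t].
Proof.
apply: eq_from_tnth => i; rewrite tnth_mktuple.
case: (unliftP ord0 i) => [k ->|->].
  rewrite tnthS tnth_mktuple; case: (unliftP j k) => [m ->|->].
    have -> : lift ord0 (lift j m) = lift (lift ord0 j) (lift ord0 m).
      by apply: val_inj; rewrite /= /bump /= !add1n ltnS; case: (j <= m)%N.
    by rewrite liftK tnthS.
  by rewrite unlift_none.
rewrite tnth0 (_ : ord0 = lift (lift ord0 j) ord0) ?liftK ?tnth0//.
exact: val_inj.
Qed.

Lemma measurable_insert n (j : 'I_n.+1) : measurable_fun setT
  (fun p : Y * n.-tuple Y => insert_tuple j p.1 p.2).
Proof.
apply/measurable_fun_tnthP => i /=.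
case: (unliftP j i) => [k ->|->].
  rewrite (_ : _ \o _ = (fun t : n.-tuple Y => tnth t k) \o snd).
    by apply: measurableT_comp; [exact: measurable_tnth|exact: measurable_snd].
  by apply/funext => p /=; rewrite tnth_mktuple liftK.
rewrite (_ : _ \o _ = fst); first exact: measurable_fst.
by apply/funext => p /=; rewrite tnth_mktuple unlift_none.
Qed.

Lemma bounded_measurable_insert n (j : 'I_n.+1) (f : n.+1.-tuple Y -> R) :
  bounded_measurable f ->
  bounded_measurable (fun p : Y * n.-tuple Y => f (insert_tuple j p.1 p.2)).
Proof. by move=> bf; apply: (bounded_measurable_comp _ bf);
  exact: measurable_insert. Qed.

(** Induction on the length: integrate out the head, use the induction hypothesis on the tail, and
    exchange the two singled-out outputs by Fubini. *)
Lemma iid_mean_insert n (j : 'I_n.+1) (f : n.+1.-tuple Y -> R) :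
  bounded_measurable f ->
  mean (iid_law n.+1) f = mean (transition W plus_one)
    (fun y => mean (iid_law n) (fun t => f (insert_tuple j y t))).
Proof.
elim: n j f => [|n IH] j f bf.
  rewrite iid_meanS//; apply: eq_mean => y; apply: eq_mean => t.
  by rewrite ord1 insert_tuple0.
case: (unliftP ord0 j) => [k ->|->]; last first.
  by rewrite iid_meanS//; do 2 (apply: eq_mean => ?); rewrite insert_tuple0.
rewrite iid_meanS//.
have bh : bounded_measurable (fun p : (Y * Y) * n.-tuple Y =>
    f [tuple of p.1.1 :: insert_tuple k p.1.2 p.2]).
  apply: (bounded_measurable_comp (h := fun p : (Y * Y) * n.-tuple Y =>
    [tuple of p.1.1 :: insert_tuple k p.1.2 p.2]) _ bf).
  apply: measurable_cons.
    by apply: measurableT_comp; [exact: measurable_fst|exact: measurable_fst].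
  apply: (measurableT_comp (f := fun p : Y * n.-tuple Y => insert_tuple k p.1 p.2)
    (g := fun p : (Y * Y) * n.-tuple Y => (p.1.2, p.2))).
    exact: measurable_insert.
  apply: measurable_fun_pair; last exact: measurable_snd.
  by apply: measurableT_comp; [exact: measurable_snd|exact: measurable_fst].
transitivity (mean (transition W plus_one) (fun z => mean (transition W plus_one)
    (fun y => mean (iid_law n) (fun t => f [tuple of z :: insert_tuple k y t])))).
  by apply: eq_mean => z; rewrite (IH k)//; exact: bounded_measurable_cons1.
rewrite (mean_swap _ _ (bounded_measurable_mean (transition W plus_one \x transition W plus_one)%E (iid_law n) bh)).
apply: eq_mean => y; rewrite iid_meanS.
  by do 2 (apply: eq_mean => ?); rewrite insert_tupleS.
exact: (bounded_measurable_section y (bounded_measurable_insert _ bf)).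
Qed.

(** Outputs read at distinct positions are again i.i.d.: the position [iota ord0] is integrated out
    first, and by injectivity the other indices avoid it. *)
Lemma iid_mean_reindex m n (iota : 'I_m -> 'I_n) (f : m.-tuple Y -> R) :
  injective iota -> bounded_measurable f ->
  mean (iid_law n) (fun t => f [tuple tnth t (iota i) | i < m]) =
  mean (iid_law m) f.
Proof.
elim: m n iota f => [|m IH] n iota f iotaI bf.
  rewrite iid_mean0 -[RHS](mean_cst (iid_law n)); apply: eq_mean => t.
  by rewrite tuple0.
case: n iota iotaI => [iota|n iota iotaI]; first by case: (iota ord0).
set j := iota ord0.
have neq i : j != iota (lift ord0 i) by rewrite (inj_eq iotaI).
(* [kap] is [iota] on the remaining indices, with positions renumbered after the deletion of [j]. *)
pose kap i : 'I_n := s2val (unlift_some (neq i)).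
have kapE i : iota (lift ord0 i) = lift j (kap i).
  by rewrite /kap; case: unlift_some.
have kapI : injective kap.
  move=> i i' e; apply: (@lift_inj _ ord0); apply: iotaI.
  by rewrite !kapE e.
have iotaE y t : [tuple tnth (insert_tuple j y t) (iota i) | i < m.+1]
    = [tuple of y :: [tuple tnth t (kap i) | i < m]].
  apply: eq_from_tnth => i; rewrite !tnth_mktuple.
  case: (unliftP ord0 i) => [k ->|->]; last by rewrite unlift_none tnth0.
  by rewrite kapE liftK tnthS tnth_mktuple.
rewrite (iid_mean_insert j); last first.
  apply: (bounded_measurable_comp (h := fun t : n.+1.-tuple Y =>
    [tuple tnth t (iota i) | i < m.+1]) _ bf).
  apply/measurable_fun_tnthP => i.
  rewrite (_ : _ \o _ = fun t : n.+1.-tuple Y => tnth t (iota i)).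
    exact: measurable_tnth.
  by apply/funext => t /=; rewrite tnth_mktuple.
rewrite iid_meanS//; apply: eq_mean => y.
rewrite -(IH n kap)//; last exact: bounded_measurable_cons1.
by apply: eq_mean => t; rewrite iotaE.
Qed.

End MemorylessMean.

(** * Independent bits and random permutations *)

Section FiniteMeans.
Set Implicit Arguments. Unset Strict Implicit.
Context (R : realType).

(** Finite counterpart of [mean_expR_le]. The predicate [A] lets it serve both for one bit and for
    the image of a point under a random permutation. *)
Lemma weighted_sum_expR_le (I : finType) (A : pred I) (p f : I -> R) (c lam : R) :
  (forall i, A i -> 0 <= p i) -> \sum_(i | A i) p i = 1 ->
  (forall i j, A i -> A j -> `|f i - f j| <= c) ->
  \sum_(i | A i) p i * expR (lam * f i)
    <= expR (lam * (\sum_(i | A i) p i * f i) + 2 * lam ^+ 2 * c ^+ 2).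
Proof.
move=> p0 p1 fc; set m := \sum_(i | A i) p i * f i.
have mfc i : A i -> `|f i - m| <= c.
  move=> Ai; have -> : f i - m = \sum_(j | A j) p j * (f i - f j).
    under eq_bigr do rewrite mulrBr; rewrite sumrB -/m; congr (_ - _).
    by rewrite -mulr_suml p1 mul1r.
  rewrite (le_trans (ler_norm_sum _ _ _))// -[c]mul1r -p1 mulr_suml.
  by apply: ler_sum => j Aj; rewrite normrM ger0_norm ?p0// ler_wpM2l ?p0// fc.
rewrite expRD.
have -> : \sum_(i | A i) p i * expR (lam * f i) =
    expR (lam * m) * \sum_(i | A i) p i * expR (lam * (f i - m)).
  rewrite mulr_sumr; apply: eq_bigr => i _.
  by rewrite mulrCA -expRD; congr (_ * expR _); ring.
rewrite ler_wpM2l ?expR_ge0//.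
have -> : expR (2 * lam ^+ 2 * c ^+ 2) =
    \sum_(i | A i) p i * (lam * (f i - m) + expR (2 * lam ^+ 2 * c ^+ 2)).
  under eq_bigr do rewrite mulrDr mulrCA mulrBr.
  rewrite big_split/= -mulr_sumr sumrB -!mulr_suml p1.
  by rewrite -/m !mul1r subrr mulr0 add0r.
apply: ler_sum => i Ai; rewrite ler_wpM2l ?p0//.
apply: le_trans (expR_le_id_expR_sqr _) _.
rewrite lerD2l ler_expR -mulrA ler_wpM2l// exprMn ler_wpM2l ?sqr_ge0//.
rewrite -[leLHS]real_normK ?num_real// lerXn2r ?nnegrE ?mfc//.
by rewrite (le_trans (normr_ge0 _) (mfc i Ai)).
Qed.

Section Bernoulli.
Context (alpha : R).

Lemma bernoulli_weight_ge0 (I : finType) (x : {ffun I -> bool}) :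
  0 <= alpha <= 1 -> 0 <= bernoulli_weight alpha x.
Proof.
by move=> /andP[a0 a1]; apply: prodr_ge0 => i _; case: (x i); rewrite ?subr_ge0.
Qed.

(** Marginals of independent bits are independent: the configurations restricting to a given [z]
    form a product family, whose weight factors over the coordinates. *)
Lemma bernoulli_sum_reindex (I J : finType) (iota : J -> I)
    (f : {ffun J -> bool} -> R) : injective iota ->
  \sum_(x : {ffun I -> bool}) bernoulli_weight alpha x * f [ffun j => x (iota j)]
  = \sum_(z : {ffun J -> bool}) bernoulli_weight alpha z * f z.
Proof.
move=> iotaI.
rewrite (partition_big (fun x : {ffun I -> bool} => [ffun j => x (iota j)]) xpredT)//=.
apply: eq_bigr => z _.
rewrite (eq_bigr (fun x => bernoulli_weight alpha x * f z)) => [|x /eqP->//].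
rewrite -mulr_suml; congr (_ * _).
(* Admissible values at [i]: only [z j] if [i = iota j], both values outside the image. *)
pose Q i := [pred b : bool | [forall j, (iota j == i) ==> (b == z j)]].
rewrite (eq_bigl (fun x : {ffun I -> bool} => x \in family Q)); last first.
  move=> x; apply/eqP/familyP => [xz i|xQ].
    by apply/forallP => j; apply/implyP => /eqP <-; rewrite -xz ffunE.
  apply/ffunP => j; rewrite ffunE; apply/eqP.
  by have /forallP/(_ j) := xQ (iota j); rewrite eqxx.
rewrite /bernoulli_weight -(bigA_distr_big_dep _ (fun _ (b : bool) =>
  if b then alpha else 1 - alpha)).
rewrite (bigID (fun i => i \in [set iota j | j in [set: J]])) /= big_imset /=;
  last first.
  by move=> j j' _ _ /iotaI.
rewrite [X in _ * X]big1 ?mulr1 => [|i iN]; last first.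
  rewrite (eq_bigl xpredT) ?big_bool/= ?subrKC ?addrC ?subrK//.
  move=> b; apply/forallP => j; apply/implyP => /eqP ij.
  by case/negP: iN; rewrite -ij imset_f.
apply: eq_big => [j|j _]; first by rewrite inE.
rewrite (eq_bigl (pred1 (z j))) ?big_pred1_eq// => b.
rewrite inE; apply/forallP/eqP => [/(_ j)|-> k]; first by rewrite eqxx => /eqP.
by apply/implyP => /eqP/iotaI ->.
Qed.

Lemma bernoulli_sum1 (I : finType) :
  \sum_(x : {ffun I -> bool}) bernoulli_weight alpha x = 1.
Proof.
(* The total mass is the marginal on the empty index set, where the only weight is an empty
   product. *)
have /(_ (fun _ => 1)) := @bernoulli_sum_reindex I 'I_0 (fun k : 'I_0 =>
  False_rect _ (notF (ltn_ord k))).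
under eq_bigr do rewrite mulr1; move=> ->; last by case.
rewrite (big_pred1 [ffun _ => false]) ?mulr1.
  by rewrite /bernoulli_weight big_ord0.
by move=> x; symmetry; apply/eqP/ffunP; case.
Qed.

Definition cons_ffun n (b : bool) (z : {ffun 'I_n -> bool}) : {ffun 'I_n.+1 -> bool} :=
  [ffun i => if unlift ord0 i is Some k then z k else b].

Lemma bernoulli_sum_cons n (f : {ffun 'I_n.+1 -> bool} -> R) :
  \sum_(x : {ffun 'I_n.+1 -> bool}) bernoulli_weight alpha x * f x =
  \sum_(b : bool) (if b then alpha else 1 - alpha) *
    \sum_(z : {ffun 'I_n -> bool}) bernoulli_weight alpha z * f (cons_ffun b z).
Proof.
under [RHS]eq_bigr do rewrite mulr_sumr.
rewrite pair_bigA /= (reindex (fun p : bool * {ffun 'I_n -> bool} =>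
  cons_ffun p.1 p.2)) /=.
  apply: eq_bigr => -[b z] _ /=; rewrite mulrA; congr (_ * _).
  rewrite /bernoulli_weight big_ord_recl ffunE unlift_none; congr (_ * _).
  by apply: eq_bigr => i _; rewrite ffunE liftK.
exists (fun x => (x ord0, [ffun k => x (lift ord0 k)])) => [[b z] _|x _] /=.
  rewrite ffunE unlift_none; congr pair; apply/ffunP => k.
  by rewrite !ffunE liftK.
apply/ffunP => i; rewrite ffunE; case: unliftP => [k ->|->] //.
by rewrite ffunE.
Qed.

(** McDiarmid's bound for bits: condition on the first bit, apply induction to the others, then
    bound the two-point average by [weighted_sum_expR_le]. *)
Lemma bernoulli_sum_expR_le (I : finType) (f : {ffun I -> bool} -> R) (c lam : R) :
  0 <= alpha <= 1 ->
  (forall (x x' : {ffun I -> bool}) i, (forall j, j != i -> x j = x' j) ->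
    `|f x - f x'| <= c) ->
  \sum_(x : {ffun I -> bool}) bernoulli_weight alpha x * expR (lam * f x)
    <= expR (lam * (\sum_(x : {ffun I -> bool}) bernoulli_weight alpha x * f x)
             + #|I|%:R * (2 * lam ^+ 2 * c ^+ 2)).
Proof.
move=> a01; set K := 2 * _ * _.
have ordcase n (g : {ffun 'I_n -> bool} -> R) :
  (forall (x x' : {ffun 'I_n -> bool}) i, (forall j, j != i -> x j = x' j) ->
    `|g x - g x'| <= c) ->
  \sum_(x : {ffun 'I_n -> bool}) bernoulli_weight alpha x * expR (lam * g x)
    <= expR (lam * (\sum_(x : {ffun 'I_n -> bool}) bernoulli_weight alpha x * g x)
             + n%:R * K).
  elim: n g => [|n IH] g gc.
    have sum0 (F : {ffun 'I_0 -> bool} -> R) : \sum_x F x = F [ffun _ => false].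
      by apply: big_pred1 => x; symmetry; apply/eqP/ffunP; case.
    by rewrite !sum0 /bernoulli_weight big_ord0 !mul1r mul0r addr0.
  pose h b := \sum_(z : {ffun 'I_n -> bool}) bernoulli_weight alpha z * g (cons_ffun b z).
  rewrite !bernoulli_sum_cons -[X in X%:R * K]add1n natrD mulrDl mul1r addrA [X in _ <= X]expRD.
  apply: (@le_trans _ _ (\sum_(b : bool) (if b then alpha else 1 - alpha) *
     (expR (lam * h b) * expR (n%:R * K)))).
    apply: ler_sum => b _; apply: ler_wpM2l.
      by case/andP: a01; case: b => //; rewrite subr_ge0.
    rewrite -expRD; apply: IH => x x' i xx'; apply: (gc _ _ (lift ord0 i)) => j.
    by rewrite !ffunE; case: unliftP => [k ->|//]; rewrite (inj_eq (@lift_inj _ _));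
      exact: xx'.
  under eq_bigr do rewrite mulrA.
  rewrite -mulr_suml ler_wpM2r ?expR_ge0//.
  apply: weighted_sum_expR_le.
  - by case/andP: a01 => ? ? [] _ //; rewrite subr_ge0.
  - by rewrite big_bool/= addrC subrK.
  (* Averaging over the other bits preserves the bound on the effect of the first one. *)
  move=> b b' _ _; rewrite /h -sumrB.
  under eq_bigr do rewrite -mulrBr.
  rewrite (le_trans (ler_norm_sum _ _ _))// -[c]mul1r -(bernoulli_sum1 'I_n) mulr_suml.
  apply: ler_sum => z _; rewrite normrM ger0_norm ?bernoulli_weight_ge0//.
  rewrite ler_wpM2l ?bernoulli_weight_ge0//; apply: (gc _ _ ord0) => j.
  by rewrite !ffunE; case: unliftP => [k ->|->].
move=> fc.
pose g (z : {ffun 'I_#|I| -> bool}) := f [ffun i => z (enum_rank i)].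
rewrite -(bernoulli_sum_reindex f (@enum_rank_inj I)).
rewrite -(bernoulli_sum_reindex (fun x => expR (lam * f x)) (@enum_rank_inj I)).
apply: (ordcase _ g) => x x' i xx'; apply: (fc _ _ (enum_val i)) => j ji.
by rewrite !ffunE; apply: xx'; apply: contra_neq ji => <-; rewrite enum_rankK.
Qed.

End Bernoulli.

(** * Uniformly random permutations *)

Section Permutations.
Context (T : finType).
Implicit Types (A : {set T}) (F : {perm T} -> R).

(** Only permutations supported in [A] are averaged, so that an induction can fix the points of [A]
    one at a time; their number is the factorial of [#|A|]. *)
Definition perm_average A F : R :=
  ((#|A| `!)%:R^-1 * \sum_(s | perm_on A s) F s)%R.

Lemma perm_average_cst A a : perm_average A (fun _ => a) = a.
Proof.
rewrite /perm_average sumr_const card_perm mulrnAr -mulrnAl -[(_ *+ _)%R]mulr_natr.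
by rewrite mulVf ?mul1r// pnatr_eq0 -lt0n fact_gt0.
Qed.

Lemma perm_average_lipschitz A F G c : (forall s, `|F s - G s|%R <= c)%R ->
  (`|perm_average A F - perm_average A G| <= c)%R.
Proof.
move=> FG; rewrite -mulrBr -sumrB normrM ger0_norm ?invr_ge0 ?ler0n//.
rewrite -[leRHS](perm_average_cst A) ler_wpM2l ?invr_ge0 ?ler0n//.
by rewrite (le_trans (ler_norm_sum _ _ _))// ler_sum.
Qed.

(* Coset decomposition: a permutation s of A with s a = b is s' * tperm a b for
   a permutation s' fixing a. *)
Lemma perm_average_rec A F a : a \in A ->
  perm_average A F =
  (\sum_(b in A) #|A|%:R^-1 * perm_average (A :\ a) (fun s => F (s * tperm a b)%g))%R.
Proof.
move=> aA; rewrite -mulr_sumr /perm_average (cardsD1 a A) aA add1n factS natrM invfM -mulrA.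
congr (_ * _)%R; rewrite -mulr_sumr; congr (_ * _)%R.
rewrite (partition_big (fun s : {perm T} => s a) (mem A)) /=; last first.
  by move=> s sA; rewrite perm_closed.
apply: eq_bigr => b bA.
rewrite (reindex_inj (mulIg (tperm a b))) /=; apply: eq_bigl => s.
apply/andP/idP => [[sA /eqP sab]|sA].
  have sa : s a = a.
    by apply: (@perm_inj _ (tperm a b)); rewrite -permM sab tpermL.
  apply/fintype.subsetP => x; rewrite !inE => sx; apply/andP; split.
    by apply: contraNneq sx => ->; rewrite sa eqxx.
  have [xa|xa] := eqVneq x a; first by rewrite xa.
  have [->//|xb] := eqVneq x b.
  apply: (fintype.subsetP sA); rewrite inE permM.
  by apply: contraNneq sx => e; rewrite -(inj_eq (@perm_inj _ (tperm a b))) e tpermD ?eqxx// eq_sym.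
have sA' : perm_on A s := fintype.subset_trans sA (finset.subsetDl _ _).
have sa : s a = a by apply: (out_perm sA); rewrite !inE eqxx.
split; last by rewrite permM sa tpermL.
apply: perm_onM => //; apply/fintype.subsetP => x; rewrite inE.
by apply: contraR => xA; rewrite tpermD//; apply: contraNneq xA => <-.
Qed.

(** The choice of [b] in [perm_average_rec] is handled by [weighted_sum_expR_le], the rest by
    induction on the support. Two choices of [b] differ by two transpositions, whence [2 * c]. *)
Lemma perm_average_expR_le A F (c lam : R) :
  (forall s x y, `|F (s * tperm x y)%g - F s|%R <= c)%R ->
  (perm_average A (fun s => expR (lam * F s)) <=
    expR (lam * perm_average A F + #|A|%:R * (2 * lam ^+ 2 * (2 * c) ^+ 2)))%R.
Proof.
move nA : #|A| => n; elim: n A nA F => [|n IH] A nA F Fc.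
  have p1 (s : {perm T}) : perm_on A s = (s == 1%g).
    move/eqP: nA; rewrite cards_eq0 => /eqP->; apply/idP/eqP => [s1|->].
      by apply/permP => x; rewrite perm1 (out_perm s1)// inE.
    by rewrite perm_on1.
  by rewrite /perm_average nA !(big_pred1 1%g)// fact0 invr1 !mul1r mul0r addr0.
set K := (2 * _ * _)%R in IH *.
have /card_gt0P[a aA] : (0 < #|A|)%N by rewrite nA.
have nA' : #|A :\ a| = n by have := cardsD1 a A; rewrite aA nA => -[].
rewrite !(perm_average_rec _ aA) -[n.+1]add1n natrD mulrDl mul1r addrA [leRHS]expRD.
pose g b := perm_average (A :\ a) (fun s => F (s * tperm a b)%g).
have inv0 : (0 <= #|A|%:R^-1 :> R)%R by rewrite invr_ge0 ler0n.
apply: (@le_trans _ _ (\sum_(b in A) #|A|%:R^-1 *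
  (expR (lam * g b) * expR (n%:R * K)))%R).
  apply: ler_sum => b bA; rewrite ler_wpM2l// -expRD; apply: IH => // s x y.
  (* Conjugation moves the transposition to the right end, so the shifted function satisfies the
     same hypothesis. *)
  have -> : (s * tperm x y * tperm a b =
      s * tperm a b * tperm (tperm a b x) (tperm a b y))%g.
    by rewrite -!mulgA; congr (_ * _)%g;
      rewrite -tpermJ conjgE tpermV !mulgA tperm2 mul1g.
  exact: Fc.
under eq_bigr do rewrite mulrA.
rewrite -mulr_suml ler_wpM2r ?expR_ge0//.
apply: weighted_sum_expR_le => //.
  by rewrite sumr_const -[LHS]mulr_natr mulVf// nA pnatr_eq0.
move=> b b' _ _; apply: perm_average_lipschitz => s.
have e : (s * tperm a b' * tperm a b' = s)%g by rewrite -mulgA tperm2 mulg1.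
rewrite (mulrDl 1%R 1%R) mul1r (_ : _ - _ = (F (s * tperm a b)%g - F s) - (F (s * tperm a b')%g - F s))%R; last by ring.
by rewrite (le_trans (ler_normB _ _))// lerD.
Qed.

End Permutations.
End FiniteMeans.

(** * Matchings, and locality of messages *)

Section Matchings.
Set Implicit Arguments. Unset Strict Implicit.
Context (dv dc n : nat).
Notation edge := (edge dv n).
Notation matching := (matching dv dc n).
Implicit Types (G : matching) (s : {perm edge}).

Lemma to_checkK G : cancel (to_check G) (to_var G).
Proof. by move=> e; apply/eqP; case/andP: (valP G) => /forallP/(_ e). Qed.

Lemma to_varK G : cancel (to_var G) (to_check G).
Proof. by move=> t; apply/eqP; case/andP: (valP G) => _ /forallP/(_ t). Qed.

Lemma matching_inj G G' : to_check G =1 to_check G' -> G = G'.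
Proof.
move=> GG'; apply: val_inj.
rewrite [val G]surjective_pairing [val G']surjective_pairing; congr pair.
  by apply/ffunP.
apply/ffunP => t; apply: (can_inj (to_checkK G')).
by rewrite -[RHS]/(to_check G' (to_var G' t)) to_varK -GG' -[RHS](to_varK G).
Qed.

Lemma matching_of_subproof (f : edge -> check_socket dv dc n) g :
  cancel f g -> cancel g f ->
  [forall e, finfun g (finfun f e) == e] && [forall t, finfun f (finfun g t) == t].
Proof. by move=> fK gK; apply/andP; split; apply/forallP => x;
  rewrite !ffunE ?fK ?gK. Qed.

Definition matching_of (f : edge -> check_socket dv dc n) g
    (fK : cancel f g) (gK : cancel g f) : matching :=
  Sub (finfun f, finfun g) (matching_of_subproof fK gK).

Lemma to_check_matching_of f g (fK : cancel f g) (gK : cancel g f) :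
  to_check (matching_of fK gK) =1 f.
Proof. by move=> e; rewrite /to_check SubK ffunE. Qed.

Definition permute s G : matching :=
  matching_of (can_comp (to_checkK G) (permK s)) (can_comp (permKV s) (to_varK G)).

Lemma to_check_permute s G e : to_check (permute s G) e = to_check G (s e).
Proof. exact: to_check_matching_of. Qed.

Lemma matching_exists : (dc %| n * dv)%N -> inhabited matching.
Proof.
move=> dvd.
have ec : #|{: edge}| = #|{: check_socket dv dc n}|.
  by rewrite !card_prod !card_ord /num_checks divnK.
pose f (e : edge) : check_socket dv dc n := enum_val (cast_ord ec (enum_rank e)).
pose g (t : check_socket dv dc n) : edge := enum_val (cast_ord (esym ec) (enum_rank t)).
have fK : cancel f g by move=> e; rewrite /f /g enum_valK cast_ordK enum_rankK.
have gK : cancel g f by move=> t; rewrite /f /g enum_valK cast_ordKV enum_rankK.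
exact: (inhabits (matching_of fK gK)).
Qed.

(** Relative to a reference matching, a uniform matching thus becomes a uniform permutation of the
    edges. *)
Lemma permute_bij G : bijective (permute^~ G).
Proof.
pose h G' := perm (can_inj (can_comp (to_varK G) (to_checkK G')) :
  injective (to_var G \o to_check G')).
exists h => [s|G'].
  by apply/permP => e; rewrite permE /= to_check_permute to_checkK.
by apply: matching_inj => e; rewrite to_check_permute permE /= to_varK.
Qed.

Context (R : realType).

Lemma matching_average_perm G (F : matching -> R) :
  \sum_G' #|matching|%:R^-1 * F G' =
  perm_average [set: edge] (fun s => F (permute s G)).
Proof.
rewrite -mulr_sumr /perm_average -(bij_eq_card (permute_bij G)); congr (_%:R^-1 * _).
  by rewrite -card_perm; apply: eq_card => s; rewrite inE; symmetry;
    apply/fintype.subsetP.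
rewrite (reindex (permute^~ G)) /=; last exact: onW_bij (permute_bij G).
by apply: eq_bigl => s; symmetry; apply/fintype.subsetP.
Qed.

(** Multiplying the permutation [s] by a transposition alters the matching only at the preimages
    under [s] of the two transposed edges. *)
Lemma matching_average_expR_le (F : matching -> R) (c lam : R) :
  (dc %| n * dv)%N ->
  (forall G G' (x y : edge), (forall e, e != x -> e != y ->
    to_check G e = to_check G' e) ->
     `|F G - F G'| <= c) ->
  \sum_G #|matching|%:R^-1 * expR (lam * F G) <=
  expR (lam * (\sum_G #|matching|%:R^-1 * F G)
        + (n * dv)%:R * (2 * lam ^+ 2 * (2 * c) ^+ 2)).
Proof.
move=> /matching_exists[G0] Fc; rewrite !(matching_average_perm G0).
have -> : (n * dv)%N = #|[set: edge]| by rewrite cardsT card_prod !card_ord.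
apply: (@perm_average_expR_le R _ _ (fun s => F (permute s G0))) => s x y.
apply: (Fc _ _ ((s^-1)%g x) ((s^-1)%g y)) => e ex ey.
rewrite !to_check_permute permM tpermD//.
  by apply: contra_neq ex => ->; rewrite permK.
by apply: contra_neq ey => ->; rewrite permK.
Qed.

End Matchings.

(** * Locality of message passing *)

Section Locality.
Set Implicit Arguments. Unset Strict Implicit.
Context (dv dc n : nat) (d d' : measure_display).
Context (Y : measurableType d) (M : measurableType d') (D : decoder dv dc Y M).
Notation edge := (edge dv n).
Notation matching := (matching dv dc n).

(** An over-approximation of the edges whose next message can depend on [S]: through the check node
    of [g], then to any socket of an adjacent variable node. Indexing by pairs of sockets gives at
    most [dc * dv] edges for each [g]. *)
Definition edge_neighbors (G : matching) (S : {set edge}) : {set edge} :=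
  \bigcup_(g in S) [set ((to_var G ((to_check G g).1, p.1)).1, p.2) | p :
    'I_dc * 'I_dv].

Lemma card_edge_neighbors G S : (#|edge_neighbors G S| <= dc * dv * #|S|)%N.
Proof.
apply: leq_trans (_ : \sum_(g in S) dc * dv <= _)%N; last first.
  by rewrite sum_nat_const mulnC.
apply: (big_ind2 (fun (A : {set edge}) k => (#|A| <= k)%N)) => [|A a B b Aa Bb|g _];
  first by rewrite cards0.
  by apply: leq_trans (leq_add Aa Bb); rewrite cardsU leq_subr.
by rewrite (leq_trans (leq_imset_card _ _))// card_prod !card_ord.
Qed.

Lemma edge_neighborsP G (S : {set edge}) (e f g : edge) :
  f.1 = e.1 -> (to_check G g).1 = (to_check G f).1 -> g \in S ->
  e \in edge_neighbors G S.
Proof.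
move=> fe gf gS; apply/bigcupP; exists g => //.
apply/imsetP; exists ((to_check G f).2, e.2) => //=.
by rewrite gf -surjective_pairing to_checkK fe -surjective_pairing.
Qed.

Lemma edge_neighbors_sub G (S : {set edge}) : S \subset edge_neighbors G S.
Proof. by apply/fintype.subsetP => e eS; exact: edge_neighborsP eS. Qed.

Definition ball G t (B : {set edge}) := iter t (edge_neighbors G) B.

Lemma card_ball G t B : (#|ball G t B| <= (dc * dv) ^ t * #|B|)%N.
Proof.
elim: t => [|t IH] /=; first by rewrite mul1n.
by rewrite (leq_trans (card_edge_neighbors _ _))// expnS -[leqRHS]mulnA leq_mul2l IH orbT.
Qed.

Lemma ball_sub G t (B : {set edge}) : B \subset ball G t B.
Proof.
elim: t => [|t IH] //=.
exact: fintype.subset_trans IH (edge_neighbors_sub _ _).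
Qed.

(* The set whose cardinal defines [num_incorrect] is a classical one. *)
Lemma num_incorrectE (G : matching) m y l :
  num_incorrect D G m y l = #|[set e : edge | incorrect D G m y l e]|.
Proof. by apply: eq_card => e; rewrite [RHS]inE; apply/idP/idP => [/set_mem|eG];
  [|exact: mem_set]. Qed.

Lemma num_incorrect_sum (R : pzSemiRingType) (G : matching) m y l :
  (num_incorrect D G m y l)%:R = \sum_(e : edge) (incorrect D G m y l e)%:R :> R.
Proof.
rewrite num_incorrectE -sum1_card natr_sum big_mkcond /=.
by apply: eq_bigr => e _; rewrite inE; case: (incorrect _ _ _ _ _ _).
Qed.

Section Perturbation.
Context (G G' : matching) (m m' : missing_process dv n) (y y' : n.-tuple Y).
Context (B : {set edge}).
Context (yB : forall e, e \notin B -> tnth y e.1 = tnth y' e.1).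
Context (mB : forall t e, e \notin B -> m t e = m' t e).
Context (GB : forall e, e \notin B -> to_check G e = to_check G' e).

(** If [e] lies outside the ball of radius [t.+1], every edge read to form its message lies outside
    the ball of radius [t], hence outside [B], and the induction hypothesis applies to it. *)
Lemma var_message_local t e : e \notin ball G t B ->
  var_message D G m y t e = var_message D G' m' y' t e.
Proof.
elim: t e => [|t IH] e /= eB; first by rewrite yB.
have sub S (x : edge) : x \notin ball G S B -> x \notin B.
  by apply: contraNN; exact: (fintype.subsetP (ball_sub _ _ _)).
have far f g : f.1 = e.1 -> (to_check G g).1 = (to_check G f).1 -> g \notin ball G t B.
  by move=> fe gf; apply: contraNN eB => gB; exact: (edge_neighborsP fe gf gB).
have eB' : e \notin B by apply: (sub t); exact: (far e e).
case: e {eB} eB' far => v j eB far /=; congr (var_map D _); rewrite (yB eB)/=;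
  congr pair.
apply: eq_mktuple => i /=.
set f : edge := (v, lift j i).
have fB : f \notin B by apply: (sub t); exact: (far f f).
rewrite /receive mB//; case: ifP => // _; rewrite -GB//.
case Gf: (to_check G f) => [c k]; congr (check_map D _).
apply: eq_mktuple => i' /=.
set g := to_var G (c, lift k i').
have Gg : to_check G g = (c, lift k i') by rewrite to_varK.
have gB : g \notin ball G t B by apply: (far f) => //; rewrite Gg Gf.
(* The matchings agree at [g], hence so do their inverses at the socket of [g]. *)
have -> : to_var G' (c, lift k i') = g.
  by rewrite -Gg GB ?to_checkK//; exact: sub gB.
by rewrite mB ?IH//; exact: sub gB.
Qed.

Lemma num_incorrect_local l (R : realType) :
  `|(num_incorrect D G m y l)%:R - (num_incorrect D G' m' y' l)%:R| <=
  ((dc * dv) ^ l * #|B|)%:R :> R.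
Proof.
have half (A A' : {set edge}) : (forall e, e \notin ball G l B ->
  (e \in A) = (e \in A')) ->
    (#|A|%:R <= #|A'|%:R + ((dc * dv) ^ l * #|B|)%:R :> R).
  move=> AA'; rewrite -natrD ler_nat.
  apply: leq_trans (_ : #|A' :|: ball G l B| <= _)%N.
    apply: subset_leq_card; apply/fintype.subsetP => e eA; rewrite inE.
    by have [|/AA' <-] := boolP (e \in ball G l B); rewrite ?orbT// eA.
  by rewrite cardsU (leq_trans (leq_subr _ _))// leq_add2l card_ball.
have eqB e : e \notin ball G l B -> incorrect D G m y l e = incorrect D G' m' y' l e.
  by move=> eB; rewrite /incorrect var_message_local.
rewrite ler_distl lerBlDr !num_incorrectE; apply/andP; split.
  by apply: half => e eB; rewrite !inE eqB.
by apply: half => e eB; rewrite !inE eqB.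
Qed.

End Perturbation.
End Locality.

(** * Computation trees *)

Section TreeMessages.
Set Implicit Arguments. Unset Strict Implicit.
Context (dv dc : nat) (d d' : measure_display).
Context (Y : measurableType d) (M : measurableType d') (D : decoder dv dc Y M).

Definition step : finType := ('I_dv.-1 * 'I_dc.-1)%type.

(* Messages on the computation tree: a word w of steps names a variable node,
   (w, Some i) the edge above its i-th child check node, and (w, None) the edge
   towards its own parent check node. *)
Fixpoint tree_message t (eta : seq step -> Y)
    (xi : seq step -> option 'I_dv.-1 -> bool) : M :=
  match t with
  | 0 => initial_map D (eta [::])
  | s.+1 =>
      var_map D (eta [::],
        [tuple (if xi [::] (Some i) then erasure D else
          check_map D [tuple
            (if xi [:: (i, k)] None then erasure D else
               tree_message s (fun w => eta ((i, k) :: w))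
                 (fun w => xi ((i, k) :: w)))
          | k < dc.-1]) | i < dv.-1])
  end.

(** A leaf has no child edges, hence the extra unit in [size w + isSome o] for downward edges. *)
Lemma eq_tree_message t eta eta' xi xi' :
  (forall w, (size w <= t)%N -> eta w = eta' w) ->
  (forall w o, (size w + isSome o <= t)%N -> xi w o = xi' w o) ->
  tree_message t eta xi = tree_message t eta' xi'.
Proof.
elim: t eta eta' xi xi' => [|t IH] eta eta' xi xi' ee xx /=; first by rewrite ee.
rewrite ee//; congr (var_map D (_, _)); apply: eq_mktuple => i.
rewrite xx//; case: ifP => // _; congr (check_map D _); apply: eq_mktuple => k.
rewrite xx//; case: ifP => // _; apply: IH => [w|w o] wt; first exact: ee.
exact: xx.
Qed.

Lemma measurable_tree_message d1 (T : measurableType d1) t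
    (eta : T -> seq step -> Y) xi :
  (forall w, measurable_fun setT (eta^~ w)) ->
  measurable_fun setT (fun u => tree_message t (eta u) xi).
Proof.
elim: t eta xi => [|t IH] eta xi meta /=.
  exact: (measurableT_comp (measurable_initial_map D) (meta [::])).
apply: (measurableT_comp (measurable_var_map D)).
apply: measurable_fun_pair; first exact: meta.
apply/measurable_fun_tnthP => i.
rewrite (_ : _ \o _ = fun u => if xi [::] (Some i) then erasure D else
    check_map D [tuple (if xi [:: (i, k)] None then erasure D else
      tree_message t (fun w => eta u ((i, k) :: w)) (fun w => xi ((i, k) :: w)))
          | k < dc.-1]); last by apply/funext => u /=; rewrite tnth_mktuple.
case: (xi [::] (Some i)); first exact: measurable_cst.
apply: (measurableT_comp (measurable_check_map D)).
apply/measurable_fun_tnthP => k.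
rewrite (_ : _ \o _ = fun u => if xi [:: (i, k)] None then erasure D else
      tree_message t (fun w => eta u ((i, k) :: w)) (fun w => xi ((i, k) :: w)));
  last by apply/funext => u /=; rewrite tnth_mktuple.
case: (xi _ None); first exact: measurable_cst.
by apply: (IH (fun u w => eta u ((i, k) :: w))) => w; exact: meta.
Qed.

Lemma measurable_decide_neq d1 (T : measurableType d1) (h : T -> M) b :
  measurable_fun setT h -> measurable_fun setT (fun u => decide D (h u) != Some b).
Proof.
move=> mh; apply: (measurable_fun_bool false) => //.
rewrite (_ : _ @^-1` _ = h @^-1` [set m | decide D m = Some b])%classic.
  exact: (mh measurableT _ (measurable_decide D b)).
by apply/seteqP; split=> u /=; [move/negbFE/eqP|move->; rewrite eqxx].
Qed.

(** * Unfolding a graph into its computation tree *)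

Section Walks.
Context (n : nat).
Notation edge := (edge dv n).
Notation matching := (matching dv dc n).
Implicit Types (G : matching) (e : edge) (w : seq step).

(** The name looks from below: this edge joins the variable node of [e] to its [i]-th other check
    node, the parent of the variable nodes reached by [child_edge]. *)
Definition parent_edge e (i : 'I_dv.-1) : edge := (e.1, lift e.2 i).

Definition child_edge G e (p : step) : edge :=
  let: (c, k) := to_check G (parent_edge e p.1) in to_var G (c, lift k p.2).

Definition walk G e w := foldl (child_edge G) e w.

(** The unfolding is valid on every graph, cycles included. The node [w] acts in iteration
    [t - size w], and the edge towards its parent check is used in the next one, hence the
    successor. *)
Lemma var_message_tree G (m : missing_process dv n) (y : n.-tuple Y) t e :
  var_message D G m y t e = tree_message t (fun w => tnth y (walk G e w).1)
   (fun w o => if o is Some i then m (t - size w)%N (parent_edge (walk G e w) i)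
               else m (t - size w).+1 (walk G e w)).
Proof.
elim: t e => [|t IH] e //=.
case: e => v j; congr (var_map D (_, _)); apply: eq_mktuple => i.
rewrite /receive /walk /= /parent_edge /=; case: ifP => // _.
case Gf: (to_check G (v, lift j i)) => [c k]; congr (check_map D _).
apply: eq_mktuple => k'.
rewrite /child_edge /parent_edge /= Gf subSS subn0; case: ifP => // _.
Qed.

Definition tree_path G := fix tp e w : seq (dart dv n) :=
  if w is p :: w' then
    (parent_edge e p.1, true) :: (child_edge G e p, false) :: tp (child_edge G e p) w'
  else [::].

Lemma to_check_child G e p :
  to_check G (child_edge G e p) =
  ((to_check G (parent_edge e p.1)).1, lift (to_check G (parent_edge e p.1)).2 p.2).
Proof.
by rewrite /child_edge; case: (to_check G (parent_edge e p.1)) => c k; rewrite to_varK.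
Qed.

Lemma child_neq_parent G e p : child_edge G e p != parent_edge e p.1.
Proof.
rewrite -(inj_eq (can_inj (to_checkK G))) to_check_child.
case: (to_check G (parent_edge e p.1)) => c k /=.
by rewrite xpair_eqE eqxx eq_sym neq_lift.
Qed.

Lemma parent_neq e i : parent_edge e i != e.
Proof. by case: e => v j; rewrite /parent_edge xpair_eqE eqxx eq_sym neq_lift. Qed.

Lemma parent_edge_inj e : injective (parent_edge e).
Proof. by move=> i i' /(congr1 snd)/lift_inj. Qed.

Lemma tree_path_path G e w : path (nonbacktracking G) (e, false) (tree_path G e w).
Proof.
elim: w e => //= p w IH e; rewrite IH andbT.
rewrite /nonbacktracking /dart_head /dart_tail /= eqxx eq_sym parent_neq /=.
by rewrite to_check_child /= eqxx eq_sym child_neq_parent.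
Qed.

Lemma size_tree_path G e w : size (tree_path G e w) = (2 * size w)%N.
Proof. by elim: w e => //= p w IH e; rewrite IH; lia. Qed.

Lemma last_tree_path G e w : last (e, false) (tree_path G e w) = (walk G e w, false).
Proof. by elim: w e => //= p w IH e; rewrite IH. Qed.

Lemma tree_path_inj G e : injective (tree_path G e).
Proof.
move=> w; elim: w e => [|p w IH] e [|p' w'] //= E.
have /parent_edge_inj pp := congr1 (fun s => (nth (e, false) s 0).1) E.
have cc : child_edge G e p = child_edge G e p' :=
  congr1 (fun s => (nth (e, false) s 1).1) E.
have {}pp : p = p'.
  have := congr1 snd (congr1 (to_check G) cc).
  by rewrite !to_check_child pp => /lift_inj;
    case: p p' pp {E cc} => [i k] [i' k'] /= -> ->.
by congr cons => //; apply: (IH (child_edge G e p)); have := congr1 (drop 2) E;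
  rewrite /= !drop0 -pp.
Qed.

Section CycleFree.
Context (G : matching) (e : edge) (l : nat).
Hypothesis cf : cycle_free G (2 * l) e.

(** Two dart paths of length at most [2 * l] with the same final node coincide by [cf], and a dart
    path determines its word. *)
Lemma walk_var_inj w w' : (size w <= l)%N -> (size w' <= l)%N ->
  (walk G e w).1 = (walk G e w').1 -> w = w'.
Proof.
move=> wl wl' ww; apply: (@tree_path_inj G e).
apply: cf; rewrite ?tree_path_path ?size_tree_path ?leq_mul2l ?wl ?wl'//.
by rewrite !last_tree_path /dart_head /= ww.
Qed.

Lemma walk_parent_inj w w' i i' : (size w < l)%N -> (size w' < l)%N ->
  parent_edge (walk G e w) i = parent_edge (walk G e w') i' -> w = w' /\ i = i'.
Proof.
move=> wl wl' ww.
have ww' : w = w' by apply: walk_var_inj; rewrite ?(ltnW wl) ?(ltnW wl')//; case: ww.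
by move: ww; rewrite -ww' => /parent_edge_inj.
Qed.

Lemma walk_neq_parent w w' i : (size w <= l)%N -> (size w' < l)%N ->
  walk G e w != parent_edge (walk G e w') i.
Proof.
move=> wl wl'; apply/eqP => ww.
have ww' : w = w' by apply: walk_var_inj; rewrite ?(ltnW wl')//; rewrite ww.
by have := parent_neq (walk G e w') i; rewrite -ww ww' eqxx.
Qed.

End CycleFree.
End Walks.
End TreeMessages.

(** * Error probability on the computation tree *)

Section TreeError.
Set Implicit Arguments. Unset Strict Implicit.
Context (R : realType) (dv dc l : nat) (d d' : measure_display).
Context (Y : measurableType d) (M : measurableType d') (W : bs_channel R Y).
Context (D : decoder dv dc Y M).
Notation step := (step dv dc).

Definition address : finType := l.-bseq step.

(** The places of the missing bits; the condition excludes child edges of nodes at depth [l]. *)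
Definition slot : finType :=
  {b : address * option 'I_dv.-1 | (size b.1 + isSome b.2 <= l)%N}.

(** The default, the empty word, is harmless: a message after [l] iterations reads only words of
    length at most [l]. *)
Definition to_address (w : seq step) : address := insubd ([bseq] : address) w.

Lemma to_addressK w : (size w <= l)%N -> to_address w = w :> seq step.
Proof. by move=> wl; rewrite /to_address val_insubd wl. Qed.

Definition tree_incorrect (z : {ffun slot -> bool}) (u : #|address|.-tuple Y) : bool :=
  decide D (tree_message D l (fun w => tnth u (enum_rank (to_address w)))
    (fun w o => if insub (to_address w, o) is Some b then z b else false))
  != Some plus_one.

Definition tree_error (alpha : R) : R :=
  \sum_(z : {ffun slot -> bool}) bernoulli_weight alpha z *
    mean (iid_law W #|address|) (fun u => (tree_incorrect z u)%:R).

Lemma bounded_measurable_tree_incorrect z :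
  bounded_measurable (fun u => (tree_incorrect z u)%:R : R).
Proof.
apply/bounded_measurable_bool/measurable_decide_neq/measurable_tree_message => w.
exact: measurable_tnth.
Qed.

Section Length.
Context (n : nat).
Implicit Types (G : matching dv dc n) (e : edge dv n).

Lemma measurable_incorrect G (m : missing_process dv n) t e :
  measurable_fun setT (fun y : n.-tuple Y => incorrect D G m y t e).
Proof.
rewrite (_ : (fun y => _) = fun y => decide D (tree_message D t (fun w =>
  tnth y (walk G e w).1)
   (fun w o => if o is Some i then m (t - size w)%N (parent_edge (walk G e w) i)
               else m (t - size w).+1 (walk G e w))) != Some plus_one).
  by apply/measurable_decide_neq/measurable_tree_message => w; exact: measurable_tnth.
by apply/funext => y; rewrite /incorrect var_message_tree.
Qed.

Lemma bounded_measurable_incorrect G (m : missing_process dv n) t e :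
  bounded_measurable (fun y : n.-tuple Y => (incorrect D G m y t e)%:R : R).
Proof. by apply: bounded_measurable_bool; exact: measurable_incorrect. Qed.

Definition slot_edge G e (b : slot) : edge dv n :=
  let: (w, o) := val b in
  if o is Some i then parent_edge (walk G e w) i else walk G e w.

Definition slot_time (b : slot) : nat :=
  let: (w, o) := val b in if o is Some i then l - size w else (l - size w).+1.

Lemma incorrect_tree G (m : missing_process dv n) (y : n.-tuple Y) e :
  incorrect D G m y l e =
  tree_incorrect [ffun b => m (slot_time b) (slot_edge G e b)]
    [tuple tnth y (walk G e (enum_val i : address)).1 | i < #|address|].
Proof.
rewrite /incorrect var_message_tree /tree_incorrect; congr (decide D _ != _).
apply: eq_tree_message => [w wl|w o wl].
  by rewrite tnth_mktuple enum_rankK to_addressK.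
have wl' : (size w <= l)%N by apply: leq_trans wl; exact: leq_addr.
have bP : (size (to_address w) + isSome o <= l)%N by rewrite to_addressK.
rewrite (insubT (fun b : address * option 'I_dv.-1 =>
  size b.1 + isSome b.2 <= l)%N (x := (to_address w, o)) bP).
rewrite ffunE /slot_time /slot_edge /= to_addressK//.
by case: o {wl bP}.
Qed.

Lemma slot_edge_inj G e : cycle_free G (2 * l) e -> injective (slot_edge G e).
Proof.
move=> cf [[w o] /= wP] [[w' o'] /= wP']; rewrite /slot_edge /= => E;
  apply: val_inj => /=.
case: o wP E => [i|] /=; case: o' wP' => [i'|] /=; rewrite ?addn1 ?addn0 => wP' wP E.
- by have [/val_inj-> ->] := walk_parent_inj cf wP wP' E.
- by have := walk_neq_parent cf i wP' wP; rewrite E eqxx.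
- by have := walk_neq_parent cf i' wP wP'; rewrite E eqxx.
- by rewrite (val_inj (walk_var_inj cf wP wP' (congr1 fst E))).
Qed.

Definition edge_error (mode : missing_mode) (alpha : R) G e : R :=
  missing_mean mode alpha l (fun x =>
    mean (iid_law W n) (fun y => (incorrect D G x y l e)%:R)).

(** Distinct nodes and edges of the tree are then distinct in the graph, so the outputs and missing
    bits that are read follow the tree law. Each edge is read in a single iteration, so both modes
    give the same value. *)
Lemma edge_error_cycle_free mode alpha G e : cycle_free G (2 * l) e ->
  edge_error mode alpha G e = tree_error alpha.
Proof.
move=> cf; have seI := slot_edge_inj cf.
pose Phi (z : {ffun slot -> bool}) := mean (iid_law W #|address|) (fun u =>
  (tree_incorrect z u)%:R).
have meanE (m : missing_process dv n) :
    mean (iid_law W n) (fun y => (incorrect D G m y l e)%:R) =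
    Phi [ffun b => m (slot_time b) (slot_edge G e b)].
  rewrite /Phi -(iid_mean_reindex W (iota := fun i => (walk G e (enum_val i :
    address)).1)).
  - by apply: eq_mean => y; rewrite incorrect_tree.
  - move=> i i' ii'; apply: enum_val_inj; apply: val_inj.
    by apply: (walk_var_inj cf _ _ ii'); exact: size_bseq.
  - exact: bounded_measurable_tree_incorrect.
rewrite /edge_error /tree_error; case: mode => /=.
  under eq_bigr do rewrite meanE.
  exact: (bernoulli_sum_reindex alpha Phi seI).
under eq_bigr do rewrite meanE.
(* Injectivity already holds on the edge component, so a time out of range, which [inord] sends to
   zero, causes no collision. *)
apply: (bernoulli_sum_reindex alpha Phi (iota := fun b => (inord (slot_time b),
  slot_edge G e b))).
by move=> b b' [_ /seI].
Qed.

End Length.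
End TreeError.

(** * Short cycles are rare *)

Section ShortCycles.
Set Implicit Arguments. Unset Strict Implicit.
Context (dv dc n : nat).
Notation edge := (edge dv n).
Notation dart := (dart dv n).
Notation matching := (matching dv dc n).
Notation port := ('I_dv * 'I_dc)%type.
Implicit Types (G : matching) (e f : edge) (a b : dart) (w : seq port).

(** Words of ports drive the exploration: at a check node the second component chooses the outgoing
    socket, at a variable node the first. The number of words of a given length does not depend on
    [n]. *)
Definition next_dart G a (p : port) : dart :=
  if a.2 then (to_var G ((to_check G a.1).1, p.2), false) else ((a.1.1, p.1), true).

Definition trace G e w : seq dart := scanl (next_dart G) (e, false) w.

Lemma nonbacktracking_next G a b : nonbacktracking G a b ->
  exists p, b = next_dart G a p.
Proof.
move=> /andP[/eqP h _]; exists (b.1.2, (to_check G b.1).2); move: h.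
rewrite /next_dart; case: a b => [x []] [y []];
  rewrite /dart_head /dart_tail //= => -[->].
  by rewrite -surjective_pairing to_checkK.
by rewrite -surjective_pairing.
Qed.

Lemma path_trace G e (p : seq dart) : path (nonbacktracking G) (e, false) p ->
  exists2 w, size w = size p & p = trace G e w.
Proof.
rewrite /trace; elim: p (e, false) => [|b p IH] a /=; first by exists [::].
move=> /andP[/nonbacktracking_next[q bq] /IH[w sw pw]].
by exists (q :: w); rewrite /= ?sw// -bq -pw.
Qed.

Lemma size_trace G e w : size (trace G e w) = size w.
Proof. by rewrite /trace size_scanl. Qed.

Definition trace_end G e w : node dv dc n := dart_head G (last (e,
  false) (trace G e w)).

Definition explored G e w1 w2 : seq edge :=
  [seq a.1 | a <- trace G e w1 ++ trace G e w2].

(** An exploration consults the matching only on the edges it traverses. *)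
Lemma eq_trace G G' e w :
  {in [seq a.1 | a <- trace G e w], to_check G =1 to_check G'} ->
  trace G' e w = trace G e w /\ trace_end G' e w = trace_end G e w.
Proof.
rewrite /trace_end /trace => GG'.
(* The starting edge is exempt: its dart points to a variable node, which the matching does not
   affect. *)
have : (e, false).2 -> to_check G (e, false).1 = to_check G' (e, false).1 by [].
elim: w (e, false) GG' => [|p w IH] a /= GG' Ga.
  by split=> //; rewrite /dart_head; case: a.2 Ga => // /(_ isT)->.
have nn : next_dart G' a p = next_dart G a p.
  have : to_check G (next_dart G a p).1 = to_check G' (next_dart G a p).1.
    by apply: GG'; rewrite mem_head.
  rewrite /next_dart; case: a.2 Ga => //= /(_ isT) Ga; rewrite to_varK Ga => E.
  by rewrite -[in RHS](to_checkK G' (to_var G _)) -E.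
rewrite nn; have [| |e1 e2] := IH (next_dart G a p).
- by move=> x xw; apply: GG'; rewrite inE xw orbT.
- by move=> _; apply: GG'; rewrite mem_head.
by split; [rewrite e1|exact: e2].
Qed.

Definition var_check_pair (h1 h2 : node dv dc n) :
  option ('I_n * 'I_(num_checks dv dc n)) :=
  match h1, h2 with
  | inl v, inr c => Some (v, c)
  | inr c, inl v => Some (v, c)
  | _, _ => None
  end.

(* The sockets p of the end nodes of two explored paths are matched by an edge
   on neither of them. *)
Definition closing G e w1 w2 (p : port) : bool :=
  if var_check_pair (trace_end G e w1) (trace_end G e w2) is Some (v, c) then
    (to_check G (v, p.1) == (c, p.2)) && ((v, p.1) \notin explored G e w1 w2)
  else false.

(** At the first depth where cycle-freeness fails, two distinct paths meet. The last dart [b] of the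
    longer one joins the end of its prefix [p] to the end of [p2], and minimality of the depth keeps
    its edge off both. *)
Lemma closing_of_not_cycle_free G L e : ~ cycle_free G L e ->
  exists w1 w2 p, [/\ (size w1 <= L)%N, (size w2 <= L)%N & closing G e w1 w2 p].
Proof.
move=> ncf.
have [t tL [cft ncft]] : exists2 t, (t < L)%N & cycle_free G t e /\ ~ cycle_free G t.+1 e.
  elim: L ncf => [[]|L IH ncf].
    by move=> p1 p2 _; rewrite leqn0 => /nilP-> _; rewrite leqn0 => /nilP->.
  have [cf|/IH[t tL h]] := pselect (cycle_free G L e); first by exists L.
  by exists t => //; exact: ltnW.
(* One of the two paths has length exactly [t.+1], since otherwise cycle-freeness at depth [t]
   applies; by symmetry it is [p1]. *)
have [p1 [p2 [P1 s1 P2 s2 [hh pp]]]] : exists p1 p2,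
    [/\ path (nonbacktracking G) (e, false) p1, size p1 = t.+1,
     path (nonbacktracking G) (e, false) p2, (size p2 <= t.+1)%N &
     dart_head G (last (e, false) p1) = dart_head G (last (e, false) p2) /\ p1 <> p2].
  apply: contrapT => none; apply: ncft => p1 p2 P1 s1 P2 s2 hh; apply: contrapT => pp.
  move: s1; rewrite leq_eqVlt => /orP[/eqP s1|s1].
    by apply: none; exists p1, p2.
  move: s2; rewrite leq_eqVlt => /orP[/eqP s2|s2].
    by apply: none; exists p2, p1; split=> //; [exact: ltnW|split=> // /esym].
  exact/pp/cft.
case/lastP: p1 => [//|p b] in P1 s1 hh pp *.
move: P1; rewrite rcons_path => /andP[P1 pb].
move: s1; rewrite size_rcons => -[s1].
have tb : dart_head G (last (e, false) p) = dart_tail G b by case/andP: pb => /eqP.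
rewrite last_rcons in hh.
have ht : dart_head G b <> dart_tail G b by rewrite /dart_head /dart_tail; case: b.2.
have prefix r c s q : path (nonbacktracking G) (e, false) q -> q = r ++ c :: s ->
    [/\ path (nonbacktracking G) (e, false) r,
        dart_head G (last (e, false) r) = dart_tail G c &
        path (nonbacktracking G) (e, false) (rcons r c)].
  move=> qP qE; move: qP; rewrite qE cat_path /= => /and3P[rP rc _].
  by rewrite rcons_path rP rc; split=> //; case/andP: rc => /eqP.
have rev c : c.1 = b.1 -> c = b \/ dart_head G c = dart_tail G b.
  case: c (b) => [c x] [b' x'] /= ->; rewrite /dart_head /dart_tail /=.
  by case: x; case: x'; auto.
have unexplored : b.1 \notin [seq a.1 | a <- p ++ p2].
  apply/negP => /mapP[c]; rewrite mem_cat => cin /esym cb.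
  have back r : r = p -> last (e, false) r = c -> False.
    by move=> -> pc; case/andP: pb => _; rewrite pc cb eqxx.
  have split_at q : c \in q -> exists r s, q = r ++ c :: s.
    by case/path.splitPr => r s; exists r, s.
  (* If [b] occurs on [p], the prefix before it ends where [p] does but is shorter; if its reverse
     occurs, [p] must end with that reverse and [b] would backtrack. *)
  case/orP: cin => /split_at[r [s E]].
    have [rP rc rcP] := prefix _ _ _ _ P1 E.
    have rt : (size r < t)%N by rewrite -s1 E size_cat /= -addSnnS leq_addr.
    case: (rev c cb) => cE.
      have rp : r = p by apply: cft; rewrite ?s1 ?(ltnW rt)// rc cE tb.
      by move: rt; rewrite rp s1 ltnn.
    apply: (back (rcons r c)); last by rewrite last_rcons.
    by apply: cft; rewrite ?s1 ?size_rcons// last_rcons cE tb.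
  (* On [p2], an occurrence of [b] forces [p2] to equal the first path; the reverse of [b] gives
     backtracking again, or, as the last dart of a path of length [t.+1], equates the two ends of
     [b]. *)
  have [rP rc rcP] := prefix _ _ _ _ P2 E.
  have rt : (size r + size s <= t)%N by move: s2; rewrite E size_cat /= addnS.
  have nils : (t <= size r)%N -> s = [::].
    by move=> tr; apply/nilP; rewrite /nilp; lia.
  case: (rev c cb) => cE.
    have rp : r = p.
      by apply: cft; rewrite ?s1 ?(leq_trans (leq_addr _ _) rt)// rc cE tb.
    by apply: pp; rewrite E nils ?rp ?s1// cE cats1.
  have [rt'|rt'] := ltnP (size r) t.
    apply: (back (rcons r c)); last by rewrite last_rcons.
    by apply: cft; rewrite ?s1// ?size_rcons// last_rcons cE tb.
  by apply: ht; rewrite hh E nils// cats1 last_rcons.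
have [w1 sw1 pw1] := path_trace P1; have [w2 sw2 pw2] := path_trace P2.
exists w1, w2, (b.1.2, (to_check G b.1).2); split.
- by rewrite sw1 s1 ltnW.
- by rewrite sw2 (leq_trans s2).
rewrite /closing /trace_end -pw1 -pw2 tb -hh.
rewrite (_ : var_check_pair _ _ = Some (b.1.1, (to_check G b.1).1)) /=; last first.
  by rewrite /dart_tail /dart_head; case: b.2.
by rewrite -!surjective_pairing eqxx /explored -pw1 -pw2.
Qed.

(** Switching argument: exchange the closing edge with any unexplored edge [f]. Both explorations
    survive, so [G] and [f] can be recovered from the new matching, and the switching is
    injective. *)
Lemma card_closing e w1 w2 p :
  (#|[set G | closing G e w1 w2 p]| * (n * dv - (size w1 + size w2)) <= #|{:
    matching}|)%N.
Proof.
pose A := [set x : matching * edge | closing x.1 e w1 w2 p & x.2 \notin explored x.1 e w1 w2].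
have cA : (#|[set G | closing G e w1 w2 p]| * (n * dv - (size w1 + size w2)) <= #|A|)%N.
  rewrite -[leqRHS]sum1_card.
  rewrite [leqRHS](eq_bigl (fun x : matching * edge => closing x.1 e w1 w2 p &&
    (x.2 \notin explored x.1 e w1 w2))); last first.
    by move=> x; rewrite inE.
  rewrite -(pair_big_dep (fun G => closing G e w1 w2 p) (fun G f =>
    f \notin explored G e w1 w2) (fun _ _ => 1%N)) /=.
  rewrite -sum1_card big_distrl /=.
  rewrite (eq_bigl (fun G => closing G e w1 w2 p)); last by move=> G; rewrite inE.
  apply: leq_sum => G _; rewrite mul1n sum1_card.
  have := cardC [in explored G e w1 w2]; rewrite card_prod !card_ord => <-.
  rewrite leq_subLR leq_add2r (leq_trans (card_size _))// size_map size_cat !size_trace.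
  exact: leqnn.
apply: leq_trans cA _.
pose base G : edge := if var_check_pair (trace_end G e w1) (trace_end G e w2) is Some (v, _)
  then (v, p.1) else e.
pose sw (x : matching * edge) := permute (tperm (base x.1) x.2) x.1.
(* After the switch, [f] is the edge at socket [p.2] of the same check node. The default [e] never
   occurs on [A], where the end nodes are a variable and a check. *)
have swK : {in A, cancel sw (fun G' => let f :=
  if var_check_pair (trace_end G' e w1) (trace_end G' e w2) is Some (_, c)
     then to_var G' (c, p.2) else e in (permute (tperm (base G') f) G', f))}.
  move=> [G f]; rewrite inE /= => /andP[cl fU]; rewrite /sw /=.
  move: (cl); rewrite /closing; case E : (var_check_pair _ _) =>
    [[v c]|//] /andP[/eqP Gv vU].
  have bE : base G = (v, p.1) by rewrite /base E.
  rewrite bE; set G' := permute (tperm (v, p.1) f) G.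
  have G'E x : to_check G' x = to_check G (tperm (v, p.1) f x) by exact:
    to_check_permute.
  (* Neither exchanged edge is explored, so the matching is unchanged along both traces. *)
  have same w : {subset trace G e w <= trace G e w1 ++ trace G e w2} ->
      {in [seq a.1 | a <- trace G e w], to_check G =1 to_check G'}.
    move=> sub _ /mapP[a /sub aw ->]; have aU : a.1 \in explored G e w1 w2 by exact:
      map_f.
    rewrite G'E tpermD//; first by apply: contraNneq vU => ->.
    by apply: contraNneq fU => ->.
  have [_ e1] : trace G' e w1 = trace G e w1 /\ trace_end G' e w1 = trace_end G e w1.
    by apply/eq_trace/same => a aw; rewrite mem_cat aw.
  have [_ e2] : trace G' e w2 = trace G e w2 /\ trace_end G' e w2 = trace_end G e w2.
    by apply/eq_trace/same => a aw; rewrite mem_cat aw orbT.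
  have bE' : base G' = (v, p.1) by rewrite /base e1 e2 E.
  have fE : to_var G' (c, p.2) = f.
    by rewrite -Gv -[RHS](to_checkK G') G'E tpermR.
  rewrite e1 e2 E bE' fE; congr pair; apply: matching_inj => x.
  by rewrite to_check_permute G'E tpermK.
by rewrite -(card_in_imset (can_in_inj swK)) max_card.
Qed.

End ShortCycles.

(** * Concentration *)

Section NotCycleFree.
Set Implicit Arguments. Unset Strict Implicit.
Context (dv dc : nat).
Notation port := ('I_dv * 'I_dc)%type.

(** The first summand comes from the union bound when [4 * L < n * dv], with
    [n * dv <= 2 * (n * dv - 2 * L)]; the second makes the bound trivial for smaller lengths. *)
Definition collision_constant L : nat :=
  (2 * #|{: L.-bseq port * L.-bseq port * port}| + 4 * L)%N.

(** Union bound of [card_closing] over two port words and a closing port; multiplied out, it stays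
    within natural numbers. *)
Lemma card_not_cycle_free L n (e : edge dv n) :
  (#|[set G : matching dv dc n | `[< ~ cycle_free G L e >]]| * (n * dv) <=
   collision_constant L * #|{: matching dv dc n}|)%N.
Proof.
set S := [set G | _]; set m := #|{: matching dv dc n}|.
have Sm : (#|S| <= m)%N by exact: max_card.
pose Omega : finType := (L.-bseq port * L.-bseq port * port)%type.
have SK : (#|S| * (n * dv - 2 * L) <= #|Omega| * m)%N.
  have SU : S \subset \bigcup_(w : Omega) [set G | closing G e w.1.1 w.1.2 w.2].
    apply/fintype.subsetP => G; rewrite inE => /asboolP/closing_of_not_cycle_free.
    move=> [w1 [w2 [p [s1 s2 cl]]]]; apply/bigcupP.
    by exists (Bseq s1, Bseq s2, p) => //; rewrite inE.
  apply: (@leq_trans (\sum_(w : Omega) #|[set G :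
    matching dv dc n | closing G e w.1.1 w.1.2 w.2]| * (n * dv - 2 * L))).
    rewrite -big_distrl /= leq_mul2r; apply/orP; right.
    apply: leq_trans (subset_leq_card SU) _.
    apply: (big_ind2 (fun (A : {set matching dv dc n}) k => (#|A| <= k)%N)) =>
      [|A a B b Aa Bb|//].
      by rewrite cards0.
    by apply: leq_trans (leq_add Aa Bb); rewrite cardsU leq_subr.
  rewrite -sum_nat_const; apply: leq_sum => -[[w1 w2] p] _ /=.
  apply: leq_trans (card_closing e w1 w2 p); rewrite leq_mul2l; apply/orP; right.
  by rewrite leq_sub2l// mul2n -addnn leq_add// size_bseq.
rewrite /collision_constant -/Omega mulnDl.
have [NL|NL] := leqP (n * dv) (4 * L).
  by apply: (leq_trans (leq_mul Sm NL)); rewrite mulnC leq_addl.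
move: (n * dv)%N NL SK => N NL SK.
have h : (#|S| * N <= 2 * (#|S| * (N - 2 * L)))%N.
  by rewrite [leqRHS]mulnCA leq_mul2l; apply/orP; right; lia.
apply: (leq_trans h); rewrite (leq_trans _ (leq_addr _ _))// -mulnA leq_mul2l.
exact: SK.
Qed.

End NotCycleFree.

(** * Averaging over the missing connections *)

Section MissingMean.
Set Implicit Arguments. Unset Strict Implicit.
Context (R : realType) (mode : missing_mode) (alpha : R) (dv n l : nat).
Hypothesis alpha01 : 0 <= alpha <= 1.
Implicit Types f g : missing_process dv n -> R.

(** Treats both modes at once: the average is over independent bits, each of which influences a
    single edge. *)
Lemma missing_meanE : exists (I : finType)
    (phi : {ffun I -> bool} -> missing_process dv n) (pi : I -> edge dv n),
  [/\ (#|I| <= l.+1 * (n * dv))%N,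
      forall f, missing_mean mode alpha l f =
        \sum_(x : {ffun I -> bool}) bernoulli_weight alpha x * f (phi x) &
      forall (x x' : {ffun I -> bool}) i, (forall j, j != i -> x j = x' j) ->
        forall t e, e != pi i -> phi x t e = phi x' t e].
Proof.
case: mode.
  exists (edge dv n), (fun x _ e => x e), id; split=> //.
  by rewrite card_prod !card_ord mulSn leq_addr.
exists ('I_l.+1 * edge dv n)%type, (fun x t e => x (inord t, e)), snd; split=> //.
  by rewrite !card_prod !card_ord.
by move=> x x' i xx' t e ei; apply: xx'; apply: contra_neq ei => <-.
Qed.

Lemma missing_mean_cst a : missing_mean mode alpha l (fun _ : missing_process dv n =>
  a) = a.
Proof.
have [I [phi [pi [_ -> _]]]] := missing_meanE.
by rewrite -mulr_suml bernoulli_sum1 mul1r.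
Qed.

Lemma le_missing_mean f g : (forall x, f x <= g x) ->
  missing_mean mode alpha l f <= missing_mean mode alpha l g.
Proof.
have [I [phi [pi [_ E _]]]] := missing_meanE; rewrite !E => fg.
by apply: ler_sum => x _; rewrite ler_wpM2l ?bernoulli_weight_ge0.
Qed.

Lemma eq_missing_mean f g : (forall x, f x = g x) ->
  missing_mean mode alpha l f = missing_mean mode alpha l g.
Proof.
have [I [phi [pi [_ E _]]]] := missing_meanE; rewrite !E => fg.
by apply: eq_bigr => x _; rewrite fg.
Qed.

Lemma missing_meanD f g : missing_mean mode alpha l (fun x => f x + g x) =
  missing_mean mode alpha l f + missing_mean mode alpha l g.
Proof.
have [I [phi [pi [_ E _]]]] := missing_meanE; rewrite !E -big_split.
by apply: eq_bigr => x _; rewrite mulrDr.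
Qed.

Lemma missing_meanZ a f : missing_mean mode alpha l (fun x => a * f x) =
  a * missing_mean mode alpha l f.
Proof.
have [I [phi [pi [_ E _]]]] := missing_meanE; rewrite !E mulr_sumr.
by apply: eq_bigr => x _; rewrite mulrCA.
Qed.

Lemma missing_mean_sum (I : Type) (r : seq I) (f : I -> missing_process dv n -> R) :
  missing_mean mode alpha l (fun x => \sum_(i <- r) f i x) =
  \sum_(i <- r) missing_mean mode alpha l (f i).
Proof.
elim: r => [|i r IH].
  rewrite big_nil -[RHS](missing_mean_cst 0).
  by apply: eq_missing_mean => x; rewrite big_nil.
rewrite big_cons -IH -missing_meanD.
by apply: eq_missing_mean => x; rewrite big_cons.
Qed.

Lemma missing_mean_lipschitz f g c : (forall x, `|f x - g x| <= c) ->
  `|missing_mean mode alpha l f - missing_mean mode alpha l g| <= c.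
Proof.
move=> fg; rewrite ler_distl; apply/andP; split.
  rewrite lerBlDr -(missing_mean_cst c) -missing_meanD; apply: le_missing_mean => x.
  by have := fg x; rewrite ler_distl => /andP[]; rewrite lerBlDr.
rewrite -(missing_mean_cst c) -missing_meanD; apply: le_missing_mean => x.
by have := fg x; rewrite ler_distl => /andP[].
Qed.

Lemma missing_mean_expR_le f c lam :
  (forall x x' e0, (forall t e, e != e0 -> x t e = x' t e) -> `|f x - f x'| <= c) ->
  missing_mean mode alpha l (fun x => expR (lam * f x)) <=
  expR (lam * missing_mean mode alpha l f
        + (l.+1 * (n * dv))%:R * (2 * lam ^+ 2 * c ^+ 2)).
Proof.
have [I [phi [pi [cI E loc]]]] := missing_meanE; rewrite !E => fc.
apply: le_trans (bernoulli_sum_expR_le (f := f \o phi) (c := c) _ alpha01 _) _.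
  by move=> x x' i xx'; apply: (fc _ _ (pi i)); exact: loc xx'.
rewrite ler_expR lerD2l ler_wpM2r ?ler_nat//.
by rewrite mulr_ge0 ?sqr_ge0// mulr_ge0 ?sqr_ge0.
Qed.

End MissingMean.

(** * Mean and deviations of the number of errors *)

Section Ensemble.
Set Implicit Arguments. Unset Strict Implicit.
Context (R : realType) (dv dc l n : nat) (d d' : measure_display).
Context (Y : measurableType d) (M : measurableType d') (W : bs_channel R Y).
Context (D : decoder dv dc Y M) (mode : missing_mode) (alpha : R).
Hypotheses (alpha01 : 0 <= alpha <= 1) (dvdn : (dc %| n * dv)%N).
Notation matching := (matching dv dc n).
Notation edge := (edge dv n).

Lemma iid_prob (b : n.-tuple Y -> bool) : measurable_fun setT b ->
  fine (iid_law W n [set y | b y]%classic) = mean (iid_law W n) (fun y => (b y)%:R).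
Proof.
move=> mb; rewrite mean_prob; last first.
  have := mb measurableT [set true]%classic I; rewrite setTI.
  by congr measurable; apply/seteqP; split=> y /=.
apply: eq_mean => y; congr (_%:R); case: (boolP (b y)) => by_.
  by rewrite mem_set.
by rewrite memNset//=; exact/negP.
Qed.

Definition ensemble_mean (F : matching -> missing_process dv n -> n.-tuple Y -> R) :
  R :=
  \sum_(G : matching) #|matching|%:R^-1 *
    missing_mean mode alpha l (fun x => mean (iid_law W n) (F G x)).

Lemma matching_weight_sum : \sum_(G : matching) #|matching|%:R^-1 = 1 :> R.
Proof.
have [G0] := matching_exists dvdn.
have c0 : #|matching|%:R != 0 :> R by rewrite pnatr_eq0 -lt0n; apply/card_gt0P;
  exists G0.
by rewrite sumr_const -[LHS]mulr_natl divff.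
Qed.

Lemma ensemble_prob_le (E : matching -> missing_process dv n -> n.-tuple Y -> bool)
    (F : matching -> missing_process dv n -> n.-tuple Y -> R) :
  (forall G x, bounded_measurable (F G x)) ->
  (forall G x, measurable_fun setT (E G x)) ->
  (forall G x y, (E G x y)%:R <= F G x y) ->
  ensemble_prob l W mode alpha (fun G x y => E G x y) <= ensemble_mean F.
Proof.
move=> bF mE EF; apply: ler_sum => G _; rewrite ler_wpM2l ?invr_ge0//.
apply: le_missing_mean => // x; rewrite iid_prob//; apply: le_mean => //.
exact: bounded_measurable_bool.
Qed.

Definition errors (G : matching) (x : missing_process dv n) (y : n.-tuple Y) : R :=
  (num_incorrect D G x y l)%:R.

Lemma bounded_measurable_errors G x : bounded_measurable (errors G x).
Proof.
rewrite (_ : errors G x = fun y => \sum_(e : edge) (incorrect D G x y l e)%:R).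
  by apply: bounded_measurable_sum => e; exact: bounded_measurable_incorrect.
by apply/funext => y; exact: num_incorrect_sum.
Qed.

(** The factor [dv] bounds the edges touched by one change: an output touches [dv] edges, a missing
    bit one, a transposition two, which is at most [dv] by [dv2]. *)
Definition change_bound : R := ((dc * dv) ^ l * dv)%:R.

Hypothesis dv2 : (2 <= dv)%N.

Lemma errors_local G G' x x' y y' (B : {set edge}) :
  (forall e, e \notin B -> tnth y e.1 = tnth y' e.1) ->
  (forall t e, e \notin B -> x t e = x' t e) ->
  (forall e, e \notin B -> to_check G e = to_check G' e) -> (#|B| <= dv)%N ->
  `|errors G x y - errors G' x' y'| <= change_bound.
Proof.
move=> yB xB GB Bdv; rewrite /errors /change_bound.
apply: le_trans (num_incorrect_local D yB xB GB l R) _.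
by rewrite ler_nat leq_mul2l Bdv orbT.
Qed.

(** With [K = 2 * lam ^+ 2 * c ^+ 2], the outputs cost at most [n * dv] times [K], the missing bits
    [l.+1] times that, and the transpositions four times that because of the doubled increment:
    [l + 6] in all, that is [2 * l + 12] after absorbing the 2 of [K]. *)
Lemma ensemble_mean_expR_le (lam : R) :
  ensemble_mean (fun G x y => expR (lam * errors G x y)) <=
  expR (lam * ensemble_mean errors
        + (n * dv)%:R * ((2 * l + 12)%:R * lam ^+ 2 * change_bound ^+ 2)).
Proof.
set c := change_bound; set K := 2 * lam ^+ 2 * c ^+ 2.
have K0 : 0 <= K by rewrite mulr_ge0 ?sqr_ge0// mulr_ge0 ?sqr_ge0.
pose mY G x := mean (iid_law W n) (errors G x).
pose mX G := missing_mean mode alpha l (mY G).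
have step1 G x : mean (iid_law W n) (fun y => expR (lam * errors G x y)) <=
    expR (n%:R * K) * expR (lam * mY G x).
  rewrite -expRD [_ * K + _]addrC; apply: iid_mean_expR_le.
    exact: bounded_measurable_errors.
  move=> y y' i yy'; apply: (errors_local (B := [set (i, j) | j : 'I_dv])) => //.
    move=> e eB; apply: yy'; apply: contraNneq eB => <-.
    by apply/imsetP; exists e.2 => //; rewrite -surjective_pairing.
  by rewrite (leq_trans (leq_imset_card _ _))// card_ord.
have step2 G : missing_mean mode alpha l
    (fun x => mean (iid_law W n) (fun y => expR (lam * errors G x y))) <=
    expR (n%:R * K) * (expR ((l.+1 * (n * dv))%:R * K) * expR (lam * mX G)).
  apply: le_trans (le_missing_mean _ _ _ (step1 G)) _ => //.
  rewrite missing_meanZ// ler_wpM2l ?expR_ge0// -expRD [_ * K + _]addrC.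
  apply: missing_mean_expR_le => // x x' e0 xx'.
  apply: mean_lipschitz => [||y]; [exact: bounded_measurable_errors..|].
  apply: (errors_local (B := [set e0])) => //; last by rewrite cards1 ltnW.
  by move=> t e; rewrite inE; exact: xx'.
set C := expR (n%:R * K) * expR ((l.+1 * (n * dv))%:R * K).
have step3 : \sum_(G : matching) #|matching|%:R^-1 * expR (lam * mX G) <=
    expR (lam * ensemble_mean errors + (n * dv)%:R * (2 * lam ^+ 2 * (2 * c) ^+ 2)).
  apply: matching_average_expR_le => // G G' e1 e2 GG'.
  apply: missing_mean_lipschitz => // x.
  apply: mean_lipschitz => [||y]; [exact: bounded_measurable_errors..|].
  apply: (errors_local (B := [set e1; e2])) => //.
    by move=> e; rewrite !inE negb_or => /andP[]; exact: GG'.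
  by rewrite cards2 (leq_trans _ dv2)// ltnS leq_b1.
apply: (@le_trans _ _ (C * \sum_(G : matching) #|matching|%:R^-1 * expR (lam * mX G))).
  rewrite mulr_sumr; apply: ler_sum => G _.
  by rewrite mulrCA ler_wpM2l ?invr_ge0// /C -mulrA; exact: step2.
apply: (le_trans (ler_wpM2l _ step3)); first by rewrite mulr_ge0 ?expR_ge0.
rewrite /C -!expRD ler_expR addrCA lerD2l.
have -> : n%:R * K + (l.+1 * (n * dv))%:R * K + (n * dv)%:R * (2 * lam ^+ 2 * (2 * c) ^+ 2) =
    n%:R * K + (n * dv)%:R * (l%:R + 5) * K.
  by rewrite natrM -natr1 /K; ring.
have -> : (n * dv)%:R * ((2 * l + 12)%:R * lam ^+ 2 * c ^+ 2) =
  (n * dv)%:R * K + (n * dv)%:R * (l%:R + 5) * K.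
  by rewrite natrD !natrM /K; ring.
by rewrite lerD2r ler_wpM2r// ler_nat leq_pmulr// (leq_trans _ dv2).
Qed.

(** By linearity the bias is a sum over [n * dv] edges, and each term is at most the probability of
    a short cycle, which is of order [1 / (n * dv)]. *)
Lemma ensemble_mean_errors_dist (q : R) L : 0 <= q <= 1 ->
  (forall (G : matching) e, cycle_free G L e ->
    edge_error l W D mode alpha G e = q) -> (0 < n)%N ->
  `|ensemble_mean errors - (n * dv)%:R * q| <= (collision_constant dv dc L)%:R.
Proof.
move=> /andP[q0 q1] cfq n0.
have N0 : 0 < (n * dv)%:R :> R by rewrite ltr0n muln_gt0 n0 (leq_trans _ dv2).
set C := (collision_constant _ _ _)%:R.
have sumE : ensemble_mean errors =
    \sum_(e : edge) \sum_(G : matching) #|matching|%:R^-1 * edge_error l W D mode alpha G e.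
  rewrite exchange_big /=; apply: eq_bigr => G _; rewrite -mulr_sumr; congr (_ * _).
  rewrite -missing_mean_sum//; apply: eq_missing_mean => // x.
  rewrite -mean_sum; last by move=> e; exact: bounded_measurable_incorrect.
  by apply: eq_mean => y; exact: num_incorrect_sum.
have each (e : edge) : `|\sum_(G : matching) #|matching|%:R^-1 * edge_error l W D mode alpha G e - q|
    <= C / (n * dv)%:R.
  have -> : \sum_(G : matching) #|matching|%:R^-1 * edge_error l W D mode alpha G e - q =
      \sum_(G : matching) #|matching|%:R^-1 * (edge_error l W D mode alpha G e - q).
    under [RHS]eq_bigr do rewrite mulrBr.
    by rewrite sumrB -mulr_suml matching_weight_sum mul1r.
  apply: le_trans (ler_norm_sum _ _ _) _.
  (* Cycle-free matchings contribute zero; on the others both the error probability and [q] lie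
     between 0 and 1. *)
  apply: (@le_trans _ _ (\sum_(G : matching) #|matching|%:R^-1 * (`[< ~ cycle_free G L e >])%:R)).
    apply: ler_sum => G _; rewrite normrM ger0_norm ?invr_ge0// ler_wpM2l ?invr_ge0//.
    have [/asboolP ncf|/asboolPn/contrapT cf] := boolP `[< ~ cycle_free G L e >];
      last first.
      by rewrite cfq// subrr normr0.
    have /andP[e0 e1] : 0 <= edge_error l W D mode alpha G e <= 1.
      apply/andP; split.
        rewrite -(missing_mean_cst mode alpha dv n l 0); apply: le_missing_mean => // x.
        rewrite -(mean_cst (iid_law W n) 0); apply: le_mean => //.
          exact: bounded_measurable_cst.
        exact: bounded_measurable_incorrect.
      rewrite -[leRHS](missing_mean_cst mode alpha dv n l);
        apply: le_missing_mean => // x.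
      rewrite -[leRHS](mean_cst (iid_law W n)); apply: le_mean => //.
      - exact: bounded_measurable_incorrect.
      - exact: bounded_measurable_cst.
      - by move=> y; rewrite -[1]/(1%:R) ler_nat leq_b1.
    by rewrite ler_norml (_ : true%:R = 1 :> R)//; lra.
  have m0 : 0 < #|matching|%:R :> R.
    by have [G0] := matching_exists dvdn; rewrite ltr0n; apply/card_gt0P; exists G0.
  rewrite -mulr_sumr mulrC ler_pdivlMr// mulrAC ler_pdivrMr//.
  have := card_not_cycle_free dc L e.
  rewrite -(ler_nat R) !natrM; apply: le_trans; rewrite ler_wpM2r ?ler0n//.
  rewrite -[X in _ <= X%:R]sum1_card natr_sum [leRHS]big_mkcond /=;
    apply: ler_sum => G _.
  by rewrite inE; case: ifP.
rewrite sumE.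
have -> : (n * dv)%:R * q = \sum_(e : edge) q.
  by rewrite sumr_const card_prod !card_ord mulr_natl.
rewrite -sumrB; apply: le_trans (ler_norm_sum _ _ _) _.
apply: le_trans (ler_sum _ (fun e _ => each e)) _.
by rewrite sumr_const card_prod !card_ord -[leLHS]mulr_natl mulrCA divff ?mulr1// gt_eqF.
Qed.

Lemma cycle_free_probE (e : edge) : cycle_free_prob dc l W mode alpha e =
  \sum_(G : matching) #|matching|%:R^-1 * `[< cycle_free G (2 * l) e >]%:R.
Proof.
apply: eq_bigr => G _; congr (_ * _).
rewrite -[RHS](missing_mean_cst mode alpha dv n l); apply: eq_missing_mean => // x.
rewrite -(mean_cst (iid_law W n) (`[< _ >]%:R)) -iid_prob; last exact: measurable_cst.
congr (fine (_ _)); apply/seteqP; split=> y /=; first by move/asboolP.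
by move/asboolP.
Qed.

(** The error probability is the same on every cycle-free matching, so it factors out of the sum and
    the conditioning probability cancels. *)
Lemma cycle_free_errorE (e : edge) : 0 < cycle_free_prob dc l W mode alpha e ->
  cycle_free_error l W D mode alpha e = tree_error l W D alpha.
Proof.
move=> p0; apply: (canLR (mulfK (lt0r_neq0 p0))).
rewrite cycle_free_probE mulr_sumr.
apply: eq_bigr => G _; rewrite mulrCA; congr (_ * _).
have [/asboolP cf|/asboolPn cf] := boolP `[< cycle_free G (2 * l) e >].
  rewrite mulr1 -(edge_error_cycle_free W D mode alpha cf);
    apply: eq_missing_mean => // x.
  rewrite -iid_prob; first by congr (fine (_ _)); apply/seteqP; split=> y /= => [[]|].
  exact: measurable_incorrect.
rewrite mulr0 -[RHS](missing_mean_cst mode alpha dv n l);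
  apply: eq_missing_mean => // x.
rewrite -[RHS]/(false%:R : R) -(mean_cst (iid_law W n) (false%:R)) -iid_prob;
  last exact: measurable_cst.
by congr (fine (_ _)); apply/seteqP; split=> y /= => [[]|].
Qed.

Lemma tree_error_itv : 0 <= tree_error l W D alpha <= 1.
Proof.
have m01 z : 0 <= mean (iid_law W #|address dv dc l|) (fun u =>
  (tree_incorrect D z u)%:R) <= 1.
  have bz := bounded_measurable_tree_incorrect R D z.
  apply/andP; split.
    rewrite -[leLHS](mean_cst (iid_law W #|address dv dc l|)); apply: le_mean => //.
    exact: bounded_measurable_cst.
  rewrite -[leRHS](mean_cst (iid_law W #|address dv dc l|)); apply: le_mean => //.
    exact: bounded_measurable_cst.
  by move=> u; rewrite -[1]/(1%:R) ler_nat leq_b1.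
apply/andP; split.
  by apply: sumr_ge0 => z _; rewrite mulr_ge0 ?bernoulli_weight_ge0//;
    case/andP: (m01 z).
rewrite -[leRHS](bernoulli_sum1 alpha (slot dv dc l)); apply: ler_sum => z _.
by rewrite ler_piMr ?bernoulli_weight_ge0//; case/andP: (m01 z).
Qed.

Lemma ensemble_mean_linear a b (F F' : matching -> missing_process dv n ->
  n.-tuple Y -> R) :
  (forall G x, bounded_measurable (F G x)) -> (forall G x,
    bounded_measurable (F' G x)) ->
  ensemble_mean (fun G x y => a * F G x y + b * F' G x y) =
  a * ensemble_mean F + b * ensemble_mean F'.
Proof.
move=> bF bF'; rewrite !mulr_sumr -big_split /=; apply: eq_bigr => G _.
rewrite !(mulrCA _ (_^-1)) -mulrDr; congr *%R.
rewrite -!missing_meanZ -missing_meanD; apply: eq_missing_mean => // x.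
by rewrite meanD ?meanZ//; exact: bounded_measurableZ.
Qed.

(* Chernoff: exponentiate both tails and apply Markov's inequality. *)
Lemma ensemble_deviation_le (E : matching -> missing_process dv n -> n.-tuple Y -> bool)
    (lam t : R) : 0 <= lam -> (forall G x, measurable_fun setT (E G x)) ->
  (forall G x y, E G x y -> t <= `|errors G x y - ensemble_mean errors|) ->
  ensemble_prob l W mode alpha (fun G x y => E G x y) <=
  2 * expR (- (lam * t)
      + (n * dv)%:R * ((2 * l + 12)%:R * lam ^+ 2 * change_bound ^+ 2)).
Proof.
move=> lam0 mE Et; set mu := ensemble_mean errors in Et *; set V := _ * (_ * _).
have bexp r G x : bounded_measurable (fun y => expR (r * errors G x y)).
  exact/bounded_measurable_expR/bounded_measurableZ/bounded_measurable_errors.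
pose F := fun G x y => expR (- (lam * t) - lam * mu) * expR (lam * errors G x y)
  + expR (- (lam * t) + lam * mu) * expR (- lam * errors G x y).
apply: (@le_trans _ _ (ensemble_mean F)).
  apply: ensemble_prob_le => // G x.
    by apply: bounded_measurableD; apply: bounded_measurableZ.
  move=> y; case: (boolP (E G x y)) => [Ey|_]; last first.
    by rewrite addr_ge0// mulr_ge0 ?expR_ge0.
  have tE := Et _ _ _ Ey.
  rewrite /F -!expRD; have [h|h] := leP 0 (errors G x y - mu).
    apply: (@le_trans _ _ (expR (- (lam * t) - lam * mu + lam * errors G x y))).
      rewrite -[true%:R]expR0 ler_expR; rewrite ger0_norm// in tE.
      have := ler_wpM2l lam0 tE; lra.
    by rewrite lerDl expR_ge0.
  apply: (@le_trans _ _ (expR (- (lam * t) + lam * mu + - lam * errors G x y))).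
    rewrite -[true%:R]expR0 ler_expR; rewrite ltr0_norm// in tE.
    have := ler_wpM2l lam0 tE; lra.
  by rewrite lerDr expR_ge0.
rewrite (ensemble_mean_linear _ _ (bexp lam) (bexp (- lam))).
have half r : expR (- (lam * t) - r * mu) *
    ensemble_mean (fun G x y => expR (r * errors G x y)) <=
    expR (- (lam * t) + (n * dv)%:R * ((2 * l + 12)%:R * r ^+ 2 * change_bound ^+ 2)).
  apply: le_trans (ler_wpM2l (expR_ge0 _) (ensemble_mean_expR_le r)) _.
  by rewrite -expRD ler_expR -/mu; lra.
have h1 := half lam; have h2 := half (- lam).
by rewrite sqrrN mulNr opprK -/V in h2; rewrite -/V in h1; lra.
Qed.

End Ensemble.

Theorem theorem3 (R : realType) (dv dc l : nat)
    (hdv : (2 <= dv)%N) (hdc : (2 <= dc)%N) :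
  exists beta gamma : R, [/\ 0 < beta, 0 < gamma &
    forall (d d' : measure_display)
           (Y : measurableType d) (M : measurableType d')
           (W : bs_channel R Y) (D : decoder dv dc Y M)
           (mode : missing_mode) (alpha : R),
      0 <= alpha <= 1 ->
      forall q : R, is_cycle_free_error l W D mode alpha q ->
      forall n : nat, (dc %| n * dv)%N ->
      forall eps : R, 0 < eps -> 2 * gamma / eps < n%:R ->
        ensemble_prob l W mode alpha
          (fun (G : matching dv dc n) x y =>
             (n * dv)%:R * eps <
               `|(num_incorrect D G x y l)%:R - (n * dv)%:R * q|)
        <= 2 * expR (- (beta * n%:R * eps ^+ 2))].
Proof.
set C := collision_constant dv dc (2 * l).
pose Q : R := (2 * l + 12)%:R * change_bound R dv dc l ^+ 2.
have dv0 : (0 < dv)%N by exact: ltnW.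
have Q0 : 0 < Q.
  rewrite mulr_gt0 ?ltr0n ?addn_gt0 ?orbT// exprn_gt0// ltr0n.
  by rewrite muln_gt0 expn_gt0 muln_gt0 (ltnW hdc) dv0.
(* With [N = n * dv], [t = N * eps / 2] and [lam = eps / (4 * Q)], the exponent
   [- (lam * t) + N * Q * lam ^+ 2] equals [- (N * eps ^+ 2 / (16 * Q))]. The successor makes
   [gamma] positive. *)
exists (dv%:R / (16 * Q)), (C.+1%:R); split.
- by rewrite divr_gt0 ?ltr0n// mulr_gt0.
- by rewrite ltr0n.
move=> d d' Y M W D mode alpha a01 q [n' [e' [dvd' p0 qE]]] n dvdn eps eps0 neps.
have {qE p0} qE : q = tree_error l W D alpha by rewrite qE; exact: cycle_free_errorE.
(* The lower bound on [n] makes the bias [C] smaller than half of the allowed deviation. *)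
have Cn : 2 * C%:R < n%:R * eps :> R.
  move: neps; rewrite ltr_pdivrMr//; apply: le_lt_trans.
  by rewrite ler_wpM2l// ler_nat.
have n0 : (0 < n)%N.
  by rewrite -(ltr0n R) -(pmulr_lgt0 _ eps0); apply: le_lt_trans Cn; rewrite mulr_ge0.
have cfq (G : matching dv dc n) e : cycle_free G (2 * l) e ->
    edge_error l W D mode alpha G e = q.
  by move=> /(edge_error_cycle_free W D mode alpha) ->.
have q01 : 0 <= q <= 1 by rewrite qE; exact: tree_error_itv.
have dist := ensemble_mean_errors_dist a01 dvdn hdv q01 cfq n0.
set N : R := (n * dv)%:R in dist *.
have nN : n%:R <= N by rewrite ler_nat leq_pmulr.
(* This [lam] minimises the exponent for [t = N * eps / 2]. *)
apply: le_trans (@ensemble_deviation_le R dv dc l n d d' Y M W D mode alpha a01 dvdn hdv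
  (fun G x y => N * eps < `|errors R l D G x y - N * q|) (eps / (4 * Q)) (N * eps / 2) _ _ _) _.
- by rewrite divr_ge0// ltW// mulr_gt0.
- move=> G x; apply: measurable_fun_ltr; first exact: measurable_cst.
  apply: measurableT_comp => //.
  have [me _] := bounded_measurable_errors R l D G x.
  by apply: measurable_funB => //; exact: measurable_cst.
- move=> G x y; set mu := ensemble_mean _ _ _ _ (errors _ _ _) in dist *;
  set Z := errors _ _ _ _ _ _ => h.
  (* A deviation of [N * eps] from [N * q], less a bias below [N * eps / 2], leaves at least
     [N * eps / 2] from the mean. *)
  have tri : `|Z - N * q| <= `|Z - mu| + `|mu - N * q| by rewrite -[X in `|X| <= _](subrKA mu) ler_normD.
  have nNe : n%:R * eps <= N * eps by rewrite ler_wpM2r// ltW.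
  by move: dist; rewrite -/C; lra.
rewrite ler_wpM2l// ler_expR -/N.
suff -> : - (eps / (4 * Q) * (N * eps / 2)) +
    N * ((2 * l + 12)%:R * (eps / (4 * Q)) ^+ 2 * change_bound R dv dc l ^+ 2)
    = - (dv%:R / (16 * Q) * n%:R * eps ^+ 2) by [].
rewrite (_ : (2 * l + 12)%:R * _ * _ = Q * (eps / (4 * Q)) ^+ 2); last by rewrite /Q;
  ring.
have Qn0 : Q != 0 by rewrite gt_eqF.
by rewrite /N natrM; field.
Qed.
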